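(* Let $\Bbbk$ be an algebraically closed field with $p=\operatorname{char}\Bbbk>0$. Let $A'$ be a finite subset of a free abelian group $M'$ (of finite rank) with $\operatorname{Aff}(A')=M'$. Let $r,c>0$ be positive integers such that $(p,r)\neq(2,1)$ and $c$ is coprime to $p$. Assume that positive integers $n,N$ satisfy $$n\ge\max\{(\#A'-1)+r,\ \operatorname{rk}(M')+r+1\}$$ and $$N\ge\begin{cases}2n-\operatorname{rk}(M')-r+1&\text{if }p\ge3,\text{ or }p=2\text{ and }r\text{ is even},\\2n-\operatorname{rk}(M')-r+2&\text{if }p=2\text{ and }r\text{ is odd}.\end{cases}$$ Then there exists a finite subset $A\subset M:=\mathbb{Z}^n$ with $\operatorname{Aff}(A)=M$ and $\#A=N+1$ such that the Gauss map $\gamma$ of $X_A\subset\mathbb{P}^N$ satisfies the following conditions: (i) (The closure of) each irreducible component of a general fiber of $\gamma$ is projectively equivalent to $X_{A'}$. (ii) The rank of $\gamma$ is equal to $r$. (iii) The number of the irreducible components of a general fiber of $\gamma$ is equal to $c$.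
   Context: For a free abelian group $M$ of finite rank, $T_M=\operatorname{Spec}\Bbbk[M]$, where $\Bbbk[M]=\bigoplus_{u\in M}\Bbbk z^u$. For a finite subset $A=\{u_0,\ldots,u_N\}\subset M$ (distinct elements), $X_A\subset\mathbb{P}^N$ is the closure of the image of $T_M\to\mathbb{P}^N$, $t\mapsto[z^{u_0}(t):\cdots:z^{u_N}(t)]$, and $\operatorname{Aff}(A)\subset M$ is the set of all $\sum_i a_iu_i$ with $a_i\in\mathbb{Z}$, $\sum_i a_i=1$. The Gauss map of an $n$-dimensional projective variety $X\subset\mathbb{P}^N$ is the rational map $\gamma: X\dashrightarrow\mathbb{G}(n,\mathbb{P}^N)$ sending each smooth point $x$ to the embedded tangent space $\mathbb{T}_xX\subset\mathbb{P}^N$. The rank of $\gamma$ is the rank of the $\Bbbk$-linear tangent map $d_x\gamma$ between Zariski tangent spaces at a general point $x\in X$. Irreducible components of fibers are considered with the reduced structure, and their closures are taken in $X$. $X_1\subset\mathbb{P}^{N_1}$ and $X_2\subset\mathbb{P}^{N_2}$ are projectively equivalent if there are linear embeddings $\jmath_i:\mathbb{P}^{N_i}\hookrightarrow\mathbb{P}^{m}$ (i.e. $\jmath_i^*\mathcal{O}(1)=\mathcal{O}(1)$) for some $m$ with $\jmath_1(X_1)=\jmath_2(X_2)$. *)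

(* Defs.v *)
From mathcomp Require Export all_boot all_order all_algebra.
From mathcomp Require Export mpoly.
From mathcomp Require Export boolp classical_sets functions cardinality.

Set Implicit Arguments.
Unset Strict Implicit.
Unset Printing Implicit Defensive.

Import GRing.Theory.

Local Open Scope ring_scope.
Local Open Scope classical_set_scope.

(* Varieties over the algebraically closed field [k] are given by their sets of
   closed points. A point of P^N is a nonzero row vector of size N.+1 up to
   scaling, and a subset of P^N is represented by the set of all homogeneous
   coordinate vectors of its points. *)

Section Zariski.
Variables (k : closedFieldType) (N : nat).
Implicit Types (X Z S C : set 'rV[k]_N.+1) (x y v : 'rV[k]_N.+1).
Implicit Types (F : {mpoly k[N.+1]}).

Definition homogeneous F : Prop := exists e : nat, F \is e.-homog.

Definition vanishes_on F X : Prop := forall x, X x -> F.@[x 0] = 0.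

Definition zariski_closed Z : Prop :=
  exists I : set {mpoly k[N.+1]}, I `<=` homogeneous /\
    Z = [set x | x != 0 /\ forall F, I F -> F.@[x 0] = 0].

Definition zariski_closure S : set 'rV[k]_N.+1 :=
  [set x | forall Z, zariski_closed Z -> S `<=` Z -> Z x].

Definition irreducible_set S : Prop :=
  S !=set0 /\ forall Z1 Z2, zariski_closed Z1 -> zariski_closed Z2 ->
    S `<=` Z1 `|` Z2 -> S `<=` Z1 \/ S `<=` Z2.

(* A maximal irreducible subset is relatively closed and stable under scaling,
   so nothing has to be required of [C] and [C'] beyond irreducibility. *)
Definition irreducible_components S : set (set 'rV[k]_N.+1) :=
  [set C | [/\ C `<=` S, irreducible_set C &
    forall C', C' `<=` S -> irreducible_set C' -> C `<=` C' -> C' = C]].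

(* [P] holds at a general point of the irreducible variety [X], i.e. on a
   nonempty relatively open subset of [X]. *)
Definition at_general_point X (P : 'rV[k]_N.+1 -> Prop) : Prop :=
  exists Z, [/\ zariski_closed Z, ~ X `<=` Z &
    forall x, X x -> ~ Z x -> P x].

(* The rational functions f_i / g on the irreducible variety [X] are
   algebraically independent over [k]. *)
Definition algebraically_independent X (d : nat)
    (f : 'I_d -> {mpoly k[N.+1]}) (g : {mpoly k[N.+1]}) : Prop :=
  [/\ exists e : nat, g \is e.-homog /\ forall i, f i \is e.-homog,
      ~ vanishes_on g X &
      forall P : {mpoly k[d]},
        (forall x, X x -> g.@[x 0] != 0 ->
           P.@[fun i => (f i).@[x 0] / g.@[x 0]] = 0) -> P = 0].

(* dim X = transcendence degree of the function field of [X]; finitely many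
   rational functions can always be written with a common denominator. *)
Definition has_dimension X (d : nat) : Prop :=
  (exists (f : 'I_d -> _) g, algebraically_independent X f g) /\
  ~ (exists (f : 'I_d.+1 -> _) g, algebraically_independent X f g).

Definition row_space (m : nat) (W : 'M[k]_(m, N.+1)) : set 'rV[k]_N.+1 :=
  [set v | (v <= W)%MS].

(* The linear subspace of k^(N+1) whose projectivization is the embedded
   tangent space T_x X. *)
Definition embedded_tangent_space X x : set 'rV[k]_N.+1 :=
  [set v | forall F, homogeneous F -> vanishes_on F X ->
    \sum_(j < N.+1) (F^`M(j)).@[x 0] * v 0 j = 0].

Definition smooth_point X x : Prop :=
  X x /\ exists d, has_dimension X d /\
    exists W : 'M[k]_(d.+1, N.+1),
      row_free W /\ embedded_tangent_space X x = row_space W.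

(* Only meaningful at smooth points. *)
Definition gauss_map X x : set 'rV[k]_N.+1 := embedded_tangent_space X x.

Definition gauss_fiber X x : set 'rV[k]_N.+1 :=
  [set y | smooth_point X y /\ gauss_map X y = gauss_map X x].

(* Near [x] the Gauss map is y |-> row space of B(y): this is how a morphism to
   the Grassmannian is given locally. *)
Definition gauss_frame X x (d : nat)
    (B : 'M[{mpoly k[N.+1]}]_(d.+1, N.+1)) : Prop :=
  exists Z, [/\ zariski_closed Z, ~ Z x &
    forall y, X y -> ~ Z y ->
      let By := map_mx (meval (y 0)) B in
      row_free By /\ gauss_map X y = row_space By].

(* The tangent space of the Grassmannian at V is Hom(V, k^(N+1) / V), and if V
   has basis the rows of B(x), then d_x gamma (v) sends the i-th row of B(x) to
   the class of the i-th row of the derivative of B at x along v. The quotient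
   by V = row space of B(x) is taken by multiplying by [cokermx]. *)
Definition frame_derivative (d : nat) (B : 'M[{mpoly k[N.+1]}]_(d.+1, N.+1))
    x v : 'M[k]_(d.+1, N.+1) :=
  \matrix_(i, j) \sum_(l < N.+1) ((B i j)^`M(l)).@[x 0] * v 0 l.

Definition gauss_differential (d : nat)
    (B : 'M[{mpoly k[N.+1]}]_(d.+1, N.+1)) x v : 'M[k]_(d.+1, N.+1) :=
  frame_derivative B x v *m cokermx (map_mx (meval (x 0)) B).

(* The Zariski tangent space of [X] at [x] is the quotient by the line through
   [x] of the row space of B(x); the differential vanishes on this line, so its
   rank is the rank of its restriction to the row space of B(x). It does not
   depend on the frame [B]. *)
Definition gauss_rank_at X x (r : nat) : Prop :=
  exists d (B : 'M[{mpoly k[N.+1]}]_(d.+1, N.+1)),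
    gauss_frame X x B /\
    \rank (map_mx (meval (x 0)) B *m
           lin1_mx (fun v => mxvec (gauss_differential B x v))) = r.

End Zariski.

(* A linear embedding P^N -> P^m is given by an injective linear map, acting
   here on row vectors from the right. *)
Definition projectively_equivalent (k : closedFieldType) (N1 N2 : nat)
    (X1 : set 'rV[k]_N1.+1) (X2 : set 'rV[k]_N2.+1) : Prop :=
  exists m (J1 : 'M[k]_(N1.+1, m.+1)) (J2 : 'M[k]_(N2.+1, m.+1)),
    [/\ row_free J1, row_free J2 &
      (fun x => x *m J1) @` X1 = (fun x => x *m J2) @` X2].

Definition free_of_rank (M : zmodType) (m : nat) : Prop :=
  exists e : 'I_m -> M, bijective (fun a : 'rV[int]_m => \sum_i e i *~ a 0 i).

(* The closed points of Spec k[M] are the k-algebra maps k[M] -> k, i.e. the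
   homomorphisms M -> k^*; the value of z^u at t is t u. *)
Definition torus (k : closedFieldType) (M : zmodType) : set (M -> k) :=
  [set t | t 0 = 1 /\ forall u v, t (u + v) = t u * t v].

(* A finite set {u_0, ..., u_N} of distinct elements is given by the injective
   family u : 'I_N.+1 -> M. *)
Definition toric_variety (k : closedFieldType) (M : zmodType) (N : nat)
    (u : 'I_N.+1 -> M) : set 'rV[k]_N.+1 :=
  zariski_closure [set x | exists t (l : k),
    [/\ torus t, l != 0 & x = l *: \row_i t (u i)]].

Arguments toric_variety k {M N} u _.

Definition Aff (M : zmodType) (N : nat) (u : 'I_N.+1 -> M) : set M :=
  [set w | exists a : 'I_N.+1 -> int,
    \sum_i a i = 1 /\ w = \sum_i u i *~ a i].

(* Main.v *)
Require Import Defs.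
From HB Require Import structures.
From mathcomp Require Import separable zify ring.

Set Implicit Arguments.
Unset Strict Implicit.
Unset Printing Implicit Defensive.

Import Order.TTheory GRing.Theory Num.Theory.

Local Open Scope ring_scope.
Local Open Scope classical_set_scope.

(** Let [u_0, ..., u_N] be the points of [A], put [v_j = (1, u_j)], and let [V]
    be the row space over [k] of the matrix with columns [v_j]. At a point [x]
    of the torus orbit [O] of [X_A], that is, at a point without zero
    coordinate, the tangent space is [diag(x) V]: monomial curves through [x]
    give the inclusion of [diag(x) V], and the binomial equations of [X_A] give
    the other one ([tangent_orbit]). Hence on [O] the Gauss map only sees the
    matroid of the vectors [v_j] modulo [p]: two points [x], [y] of [O] have
    the same tangent space iff [diag(y/x)] preserves [V], iff [y/x] is constant
    on the connected components of that matroid, and the rank of the Gauss map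
    at [x] is the dimension of [V] modulo the vectors of [V] that are constant
    on these components.

    The configuration [A] is chosen so that this matroid has one component of
    rank [r + 1], the block, and all other points are coloops. Then the
    vectors of [V] that are constant on the block have codimension [r]
    ([torus_gauss_rank]). If [L] denotes the lattice spanned by the
    differences of the points of the block, then the fiber through [x] meets
    [O] in [x] times the group of characters of [Z^n] that are trivial on [L].
    Characters with values in characteristic [p] ignore [p]-torsion, so if
    [Z^n / L] is the sum of [M'], of a finite [p]-group and of [Z / c], this
    group consists of [c] cosets of the torus of [M'], indexed by the [c]-th
    roots of unity; and if the [u_j] map onto [A'] in [M'], every coset is a
    copy of the orbit of [X_A'] ([orbit_fiberE], [fiber_component_closure]).

    To get such an [A], write [Z^n = Z^r + Z^d] with bases [e_i] and [f_i], and
    let [f_i] go to [A'_i - A'_0] in [M'], or to [0] once [A'] is exhausted.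
    The kernel of [Z^d -> M'] has a basis [g_1, ..., g_q] with [q >= 1]. Take
    the points [0], [e_i], [f_i]; one or two affine combinations of [0], [e_1],
    ..., [e_r] that make these points one component modulo [p]; the points
    [p g_1], ..., [p g_(q-1)]; and finally [pc g_q], [2 pc g_q], ... as often
    as needed. All but the [f_i] form the block. The combinations have to
    have coefficients that are nonzero modulo [p] and sum to [1]
    ([block_relations]); for [p = 2] and odd [r] a single one would have an
    even number of odd coefficients, so two are needed, and for
    [(p, r) = (2, 1)] none exist.

    A fiber of the Gauss map also contains smooth points [y] of [X_A] with zero
    coordinates; these are limits of points of the same fiber in [O]. Suppose
    that the tangent space at [y] is [diag(x) V]. It always contains [diag(y) V], so
    [y/x] is constant on the block. This constant is not zero: otherwise a
    one-parameter subgroup fixing [y] would preserve [diag(x) V], hence [V],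
    which a coefficient [-1] in one of the combinations forbids
    ([boundary_block_neq0]). If the coordinate of [y] at a coloop [f] vanishes,
    then no point of the block involves [f], since otherwise the tangent space
    at [y] would contain a vector that is not in [diag(x) V]
    ([boundary_coord_eq0]). So the vanishing coordinates can be replaced by a
    parameter [s] without leaving the fiber, and [y] is the limit for [s] going
    to [0] of points of the fiber in [O] ([boundary_in_closure]). The
    components of the whole fiber are therefore cut out by the closures of the
    [c] cosets. *)

(** * Zariski closed sets and irreducible components *)

Section ZariskiTopology.
Variables (k : closedFieldType) (N : nat).
Implicit Types (S T Z C : set 'rV[k]_N.+1) (x y : 'rV[k]_N.+1).
Implicit Types (F G : {mpoly k[N.+1]}).

Definition nonzero_set S := forall x, S x -> x != 0.

Definition zero_locus (I : set {mpoly k[N.+1]}) : set 'rV[k]_N.+1 :=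
  fun x => x != 0 /\ forall F, I F -> F.@[x 0] = 0.

(** The condition [x != 0] in [zariski_closed] is elaborated on the entry
    function of [x]; here it is stated on the vector itself. *)
Lemma zariski_closedP Z : zariski_closed Z <->
  exists I, I `<=` @homogeneous k N /\ Z = zero_locus I.
Proof.
have E (I : set {mpoly k[N.+1]}) :
    zero_locus I = [set x | x != 0 /\ forall F, I F -> F.@[x 0] = 0].
  rewrite predeqE => x /=; suff -> : (fun_of_matrix x != 0) = (x != 0) by [].
  congr negb; apply/eqP/eqP => [x0|->]; first by apply/matrixP => i j; rewrite x0 mxE.
  by apply/funext => i; apply/funext => j; rewrite mxE.
by split=> -[I [hI ->]]; exists I; split=> //; rewrite E.
Qed.

Lemma closed_nonzero Z : zariski_closed Z -> nonzero_set Z.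
Proof. by move=> /zariski_closedP[I [hI ->]] x []. Qed.

Lemma closed_zero_locus (I : set {mpoly k[N.+1]}) : I `<=` @homogeneous k N ->
  zariski_closed (zero_locus I).
Proof. by move=> hI; apply/zariski_closedP; exists I. Qed.

Lemma closureP S x : nonzero_set S ->
  zariski_closure S x <->
  x != 0 /\ forall F, homogeneous F -> vanishes_on F S -> F.@[x 0] = 0.
Proof.
move=> S0; split=> [cSx|[x0 hx] Z /zariski_closedP[I [hI ->]] SZ].
  pose I := [set F : {mpoly k[N.+1]} | homogeneous F /\ vanishes_on F S].
  have hI : I `<=` @homogeneous k N by move=> F [].
  have := cSx _ (closed_zero_locus hI).
  case=> [s Ss|x0 h]; first by split; [exact: S0|move=> F [_ /(_ _ Ss)]].
  by split=> // F hF vF; apply: h.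
split=> // F IF; apply: hx; first exact: hI.
by move=> s /SZ[_]; apply.
Qed.

Lemma closure_vanishing S F : homogeneous F -> nonzero_set S ->
  vanishes_on F S -> vanishes_on F (zariski_closure S).
Proof. by move=> hF S0 vF x /closureP-/(_ S0)[_]; apply. Qed.

Lemma sub_closure S : S `<=` zariski_closure S.
Proof. by move=> x Sx Z _; apply. Qed.

Lemma closure_min S Z : zariski_closed Z -> S `<=` Z -> zariski_closure S `<=` Z.
Proof. by move=> cZ SZ x; apply. Qed.

Lemma closure_closed S : nonzero_set S -> zariski_closed (zariski_closure S).
Proof.
move=> S0; pose I := [set F : {mpoly k[N.+1]} | homogeneous F /\ vanishes_on F S].
apply/zariski_closedP; exists I; split; first by move=> F [].
rewrite predeqE => x; rewrite (closureP _ S0) /=; split=> -[x0 h]; split=> //.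
  by move=> F []; apply: h.
by move=> F hF vF; apply: h.
Qed.

Lemma closure_nonzero S : nonzero_set S -> nonzero_set (zariski_closure S).
Proof. by move=> /closure_closed/closed_nonzero. Qed.

Lemma closure_mono S T : S `<=` T -> zariski_closure S `<=` zariski_closure T.
Proof. by move=> ST x cSx Z cZ TZ; apply: cSx => //; apply: subset_trans TZ. Qed.

Lemma closure_between S T : nonzero_set S -> S `<=` T ->
  T `<=` zariski_closure S -> zariski_closure T = zariski_closure S.
Proof.
move=> S0 ST TS; apply/seteqP; split; last exact: closure_mono.
exact: closure_min (closure_closed S0) TS.
Qed.

Lemma zariski_closedU Z1 Z2 :
  zariski_closed Z1 -> zariski_closed Z2 -> zariski_closed (Z1 `|` Z2).
Proof.
move=> /zariski_closedP[I1 [h1 ->]] /zariski_closedP[I2 [h2 ->]].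
pose I := [set F | exists F1 F2, [/\ I1 F1, I2 F2 & F = F1 * F2]].
apply/zariski_closedP; exists I; split=> [F [F1 [F2 [/h1[e1 h1F] /h2[e2 h2F] ->]]]|].
  by exists (e1 + e2)%N; apply: dhomogM.
rewrite predeqE => x /=; split.
  case=> -[x0 h]; split=> // _ [F1 [F2 [i1 i2 ->]]]; rewrite mevalM.
    by rewrite h // mul0r.
  by rewrite (h F2) // mulr0.
case=> x0 h; have [h1x|/existsNP[F1 /not_implyP[i1 n1]]] :=
  pselect (forall F, I1 F -> F.@[x 0] = 0); first by left.
right; split=> // F2 i2; have := h _ (ex_intro _ F1 (ex_intro _ F2 (And3 i1 i2 erefl))).
by move/eqP; rewrite mevalM mulf_eq0 => /orP[/eqP//|/eqP].
Qed.

Lemma zariski_closed0 : zariski_closed (set0 : set 'rV[k]_N.+1).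
Proof.
apply/zariski_closedP; exists [set 1]; split.
  by move=> _ ->; exists 0%N; apply: dhomog1.
rewrite predeqE => x /=; split=> // -[_ /(_ 1 erefl)].
by rewrite meval1 => /eqP; rewrite oner_eq0.
Qed.

Lemma irreducible_between S T : irreducible_set S -> S `<=` T ->
  T `<=` zariski_closure S -> irreducible_set T.
Proof.
move=> [[s Ss] irrS] ST TS; split; first by exists s; apply: ST.
move=> Z1 Z2 c1 c2 TZ; have [//|//|x /ST/TZ //||] := irrS Z1 Z2.
- by move=> h; left; apply: subset_trans TS (closure_min c1 h).
- by move=> h; right; apply: subset_trans TS (closure_min c2 h).
Qed.

Lemma closed_bigU (I : eqType) (s : seq I) (Z : I -> set 'rV[k]_N.+1) :
  (forall i, zariski_closed (Z i)) ->
  zariski_closed [set x | exists2 i, i \in s & Z i x].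
Proof.
move=> cZ; elim: s => [|i s IHs].
  rewrite (_ : mkset _ = set0); first exact: zariski_closed0.
  by rewrite predeqE => x; split=> // -[].
rewrite (_ : mkset _ = Z i `|` [set x | exists2 i, i \in s & Z i x]).
  exact: zariski_closedU.
rewrite predeqE => x; split=> [[j]|[Zx|[j js Zx]]] /=.
- by rewrite inE => /orP[/eqP->|js] Zx; [left|right; exists j].
- by exists i => //; rewrite mem_head.
- by exists j => //; rewrite inE js orbT.
Qed.

Lemma irreducible_bigU (I : eqType) (s : seq I) S (Z : I -> set 'rV[k]_N.+1) :
  (forall i, zariski_closed (Z i)) -> irreducible_set S ->
  S `<=` [set x | exists2 i, i \in s & Z i x] -> exists2 i, i \in s & S `<=` Z i.
Proof.
move=> cZ irrS; have [[x Sx] irr] := irrS.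
elim: s => [|i s IHs] SZ; first by have [] := SZ x Sx.
have [|||SZi|/IHs[j js SZj]] := irr (Z i) [set x | exists2 i, i \in s & Z i x] => //.
- exact: closed_bigU.
- move=> y /SZ[j]; rewrite inE => /orP[/eqP->|js] Zy; [by left|by right; exists j].
- by exists i => //; rewrite mem_head.
- by exists j => //; rewrite inE js orbT.
Qed.

(** If irreducible subsets [C i] of [E] have closures that cover [E] and none of
    them lies in the closure of another one, then the components of [E] are the
    traces on [E] of these closures. *)
Section Components.
Variables (I : eqType) (s : seq I) (C : I -> set 'rV[k]_N.+1) (E : set 'rV[k]_N.+1).
Hypotheses (C0 : forall i, nonzero_set (C i)).
Hypothesis (Cirr : forall i, irreducible_set (C i)).
Hypothesis (CE : forall i, i \in s -> C i `<=` E).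
Hypothesis (EC : E `<=` [set x | exists2 i, i \in s & zariski_closure (C i) x]).
Hypothesis (Cinj : forall i j, i \in s -> j \in s ->
  C i `<=` zariski_closure (C j) -> i = j).

Let D i := E `&` zariski_closure (C i).

Let CD i : i \in s -> C i `<=` D i.
Proof. by move=> si x Cx; split; [exact: CE Cx|exact: sub_closure]. Qed.

Lemma component_closure i : i \in s -> zariski_closure (D i) = zariski_closure (C i).
Proof. by move=> si; apply: closure_between => //; [exact: CD|move=> x []]. Qed.

Let irrD i : i \in s -> irreducible_set (D i).
Proof. by move=> si; apply: irreducible_between (Cirr i) (CD si) _; move=> x []. Qed.

Lemma irreducible_componentsE : irreducible_components E = D @` [set` s].
Proof.
have sub A : A `<=` E -> irreducible_set A -> exists2 i, i \in s & A `<=` D i.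
  move=> AE irrA.
  have [|i si Ai] := irreducible_bigU (s := s)
    (fun i => closure_closed (@C0 i)) irrA; first exact: subset_trans AE EC.
  by exists i => // x Ax; split; [exact: AE|exact: Ai].
rewrite predeqE => A; split=> [[AE irrA maxA]|[i /= si <-]].
  have [i si Ai] := sub A AE irrA; exists i => //=.
  by apply: maxA => //; [move=> x []|exact: irrD].
split; [by move=> x []|exact: irrD|move=> A' A'E irrA' DA'].
have [j sj A'j] := sub A' A'E irrA'.
have ij : i = j.
  by apply: Cinj => // x /(CD si)/DA'/A'j[].
by rewrite eqEsubset; split=> //; rewrite ij.
Qed.

Lemma component_inj : {in [set` s] &, injective D}.
Proof.
move=> i j; rewrite !inE /= => si sj Dij; apply: Cinj => // x /(CD si).
by rewrite Dij => -[].
Qed.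

End Components.
End ZariskiTopology.

(** * Linear changes of coordinates *)

Section LinearPullback.
Variables (k : closedFieldType) (a b : nat).

Definition lin_pull (J : 'M[k]_(a.+1, b.+1)) (F : {mpoly k[b.+1]}) :
    {mpoly k[a.+1]} :=
  F \mPo [tuple \sum_(i < a.+1) J i j *: 'X_i | j < b.+1].

Lemma lin_pullE J F (x : 'rV[k]_a.+1) : (lin_pull J F).@[x 0] = F.@[(x *m J) 0].
Proof.
rewrite /lin_pull comp_mpoly_meval; apply: meval_eq => j.
rewrite tnth_mktuple raddf_sum mxE /=; apply: eq_bigr => i _.
by rewrite mevalZ mevalXU mulrC.
Qed.

Lemma lin_pull_homog J F : homogeneous F -> homogeneous (lin_pull J F).
Proof.
move=> [e hF]; exists e; rewrite /lin_pull comp_mpolyEX.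
rewrite big_seq; apply: rpred_sum => m mF; rewrite rpredZ //.
rewrite comp_mpolyX -(dhomog_mf hF mF).
set T := mktuple _.
suff : \prod_(i < b.+1) tnth T i ^+ m i \is (\sum_i m i)%N.-homog by rewrite -mdegE.
elim/big_rec2: _ => [|j d P _ hP]; first exact: dhomog1.
apply: dhomogM hP; rewrite -[X in X.-homog]mul1n; apply: dhomogMn.
rewrite tnth_mktuple; apply: rpred_sum => i _; rewrite rpredZ //.
by rewrite dhomogX; apply/eqP/mdeg1.
Qed.

End LinearPullback.

(** The image of an injective linear map is cut out by linear forms, and on it
    the pseudo-inverse pulls equations back. *)
Lemma closure_linear (k : closedFieldType) (a b : nat) (J : 'M[k]_(a.+1, b.+1))
    (S : set 'rV[k]_a.+1) :
  row_free J -> nonzero_set S ->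
  zariski_closure ((fun x => x *m J) @` S) = (fun x => x *m J) @` zariski_closure S.
Proof.
move=> fJ S0; have JK := mulmxKp fJ.
have SJ0 : nonzero_set ((fun x => x *m J) @` S).
  move=> _ [x Sx <-]; apply: contraNneq (S0 x Sx) => xJ0.
  by rewrite -(JK _ x) xJ0 mul0mx.
rewrite predeqE => y; split; last first.
  case=> x /(closureP _ S0)[x0 hx] <-; apply/closureP => //; split.
    by apply: contraNneq x0 => xJ0; rewrite -(JK _ x) xJ0 mul0mx.
  move=> F hF vF; rewrite -lin_pullE; apply: hx; first exact: lin_pull_homog.
  by move=> s Ss; rewrite lin_pullE; apply: vF; exists s.
move=> /(closureP _ SJ0)[y0 hy].
have yJ : y *m pinvmx J *m J = y.
  apply/rowP => j.
  pose F : {mpoly k[b.+1]} := 'X_j - \sum_(i < b.+1) (pinvmx J *m J) i j *: 'X_i.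
  have FE (z : 'rV_b.+1) : F.@[z 0] = z 0 j - (z *m pinvmx J *m J) 0 j.
    rewrite mevalB mevalXU; congr (_ - _); rewrite raddf_sum -mulmxA mxE /=.
    by apply: eq_bigr => i _; rewrite mevalZ mevalXU mulrC.
  apply/esym/eqP; rewrite -subr_eq0 -FE; apply/eqP/hy.
    have X1 i : ('X_i : {mpoly k[b.+1]}) \is 1.-homog by rewrite dhomogX; apply/eqP/mdeg1.
    exists 1%N; rewrite rpredB ?X1 //; apply: rpred_sum => i _.
    by rewrite rpredZ.
  by move=> _ [s Ss <-]; rewrite FE JK subrr.
exists (y *m pinvmx J) => //; apply/closureP => //; split.
  by apply: contraNneq y0 => yJ0; rewrite -yJ yJ0 mul0mx.
move=> F hF vF; rewrite -lin_pullE; apply: hy; first exact: lin_pull_homog.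
by move=> _ [s Ss <-]; rewrite lin_pullE JK; apply: vF.
Qed.

Lemma irreducible_linear (k : closedFieldType) (a b : nat) (J : 'M[k]_(a.+1, b.+1))
    (S : set 'rV[k]_a.+1) : row_free J -> nonzero_set S ->
  irreducible_set S -> irreducible_set ((fun x => x *m J) @` S).
Proof.
move=> fJ S0 [[s Ss] irr]; split; first by exists (s *m J), s.
have pre Z : zariski_closed Z -> exists2 Z' : set 'rV[k]_a.+1, zariski_closed Z' &
    forall x, S x -> (Z' x <-> Z (x *m J)).
  move=> /zariski_closedP[I [hI ->]].
  exists (zero_locus [set lin_pull J F | F in I]).
    by apply: closed_zero_locus => _ [F /hI hF <-]; apply: lin_pull_homog.
  move=> x Sx; split=> -[x0 h]; split.
  - by apply: contraNneq x0 => xJ0; rewrite -(mulmxKp fJ x) xJ0 mul0mx.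
  - by move=> F IF; rewrite -lin_pullE; apply: h; exists F.
  - exact: S0.
  - by move=> _ [F IF <-]; rewrite lin_pullE; apply: h.
move=> Z1 Z2 /pre[Z1' c1 h1] /pre[Z2' c2 h2] SZ.
have [//|//|x Sx|h|h] := irr Z1' Z2'.
- have [|Z1x|Z2x] := SZ (x *m J); first by exists x.
    by left; apply/h1.
  by right; apply/h2.
- by left=> _ [x Sx <-]; apply/h1 => //; apply: h.
- by right=> _ [x Sx <-]; apply/h2 => //; apply: h.
Qed.

(** * Polynomials along curves *)

Section PolynomialCurves.
Variable k : closedFieldType.

Lemma poly_vanishing (P : {poly k}) : (forall s, s != 0 -> P.[s] = 0) -> P = 0.
Proof.
move=> hP; apply/eqP; apply: contraT => P0.
have Q0 : 'X * P != 0 by rewrite mulf_neq0 ?polyX_eq0.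
have hQ s : ('X * P).[s] = 0.
  rewrite hornerM hornerX; have [->|/hP->] := eqVneq s 0; by rewrite ?mul0r ?mulr0.
have sQ : (1 < size ('X * P)%R)%N.
  by rewrite mulrC size_mulX // ltnS lt0n size_poly_eq0.
have /closed_rootP[s] : size ('X * P - 1) != 1%N.
  by rewrite size_polyDl ?size_polyN ?size_poly1 // neq_ltn sQ orbT.
by rewrite /root hornerD hornerN hornerC hQ sub0r oppr_eq0 oner_eq0.
Qed.

Lemma poly_nonvanishing (P : {poly k}) : P != 0 -> exists2 s, s != 0 & P.[s] != 0.
Proof.
move=> P0; apply: contrapT => h; move/eqP: P0; apply; apply: poly_vanishing => s s0.
by apply/eqP; apply: contrapT => /negP Ps; apply: h; exists s.
Qed.

Variable N : nat.
Implicit Types (F : {mpoly k[N]}) (c : 'I_N -> {poly k}).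

Lemma mevalZ_homog e F (a : k) (v : 'I_N -> k) : F \is e.-homog ->
  F.@[fun j => a * v j] = a ^+ e * F.@[v].
Proof.
move=> hF; rewrite !mevalE mulr_sumr [LHS]big_seq [RHS]big_seq; apply: eq_bigr => m mF.
rewrite mulrCA; congr (_ * _).
under eq_bigr do rewrite exprMn.
rewrite big_split /=; congr (_ * _); rewrite prodrXr; congr (_ ^+ _).
by rewrite -mdegE; exact: dhomog_mf hF _ mF.
Qed.

Lemma mderivU (i j : 'I_N) : ('X_i : {mpoly k[N]})^`M(j) = (i == j)%:R.
Proof.
rewrite mderivX mnm1E; case: eqP => [<-|_]; last by rewrite scale0r.
have -> : (U_(i) - U_(i))%MM = 0%MM by apply/mnmP => l; rewrite mnmBE mnm0E subnn.
by rewrite mpolyX0 scale1r.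
Qed.

Lemma prod_vars_homog (I : finType) (f : I -> 'I_N) (e : I -> nat) :
  (\prod_i 'X_(f i) ^+ e i : {mpoly k[N]}) \is (\sum_i e i)%N.-homog.
Proof.
elim/big_rec2: _ => [|i d P _ hP]; first exact: dhomog1.
apply: dhomogM hP; rewrite -[X in X.-homog]mul1n; apply: dhomogMn.
by rewrite dhomogX; apply/eqP/mdeg1.
Qed.

Lemma prod_vars_eval (I : finType) (f : I -> 'I_N) (e : I -> nat) (v : 'I_N -> k) :
  (\prod_i 'X_(f i) ^+ e i).@[v] = \prod_i v (f i) ^+ e i.
Proof.
by rewrite rmorph_prod; apply: eq_bigr => i _; rewrite rmorphXn /= mevalXU.
Qed.

Definition along F c : {poly k} := mmap (@polyC k) c F.

Lemma along_horner F c s : (along F c).[s] = F.@[fun j => (c j).[s]].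
Proof.
rewrite /along mevalE /mmap horner_sum; apply: eq_bigr => m _.
rewrite hornerM hornerC /mmap1 horner_prod; congr (_ * _).
by apply: eq_bigr => j _; rewrite horner_exp.
Qed.

Lemma along_deriv F c : (along F c)^`() = \sum_j along F^`M(j) c * (c j)^`().
Proof.
pose chain F := (along F c)^`() = \sum_j along F^`M(j) c * (c j)^`().
have chainC a : chain a%:MP.
  rewrite /chain /along mmapC derivC big1 // => j _.
  by rewrite mderivC mmap0 mul0r.
have chainM F1 F2 : chain F1 -> chain F2 -> chain (F1 * F2).
  rewrite /chain /along rmorphM derivM => -> ->.
  rewrite mulr_suml mulr_sumr -big_split; apply: eq_bigr => j _ /=.
  by rewrite mderivM rmorphD !rmorphM /= mulrDl -!mulrA [X in _ * X + _]mulrC.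
have chainD F1 F2 : chain F1 -> chain F2 -> chain (F1 + F2).
  rewrite /chain /along raddfD derivD => -> ->.
  rewrite -big_split; apply: eq_bigr => j _ /=.
  by rewrite mderivD raddfD /= mulrDl.
have chainU i : chain 'X_i.
  rewrite /chain /along mmapX mmap1U (bigD1 i) //= big1 ?addr0 => [|j ji].
    by rewrite mderivU eqxx rmorph1 mul1r.
  by rewrite mderivU eq_sym (negPf ji) rmorph0 mul0r.
elim/mpolyind: F => [|a m F _ _ IH]; first exact: (chainC 0).
apply: chainD IH; rewrite -mul_mpolyC; apply: (chainM); first exact: chainC.
rewrite mpolyXE_id; elim/big_ind: _ => [||i _]; first exact: (chainC 1).
  exact: chainM.
by elim: (m i) => [|d IHd]; [exact: (chainC 1)|rewrite exprS; exact: chainM].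
Qed.

(** This makes Kronecker substitution injective on monomials of small degree;
    see [mpoly_vanishing]. *)
Lemma base_expansion_inj D n (a b : 'I_n -> nat) :
  (forall i, a i < D)%N -> (forall i, b i < D)%N ->
  (\sum_i a i * D ^ i = \sum_i b i * D ^ i)%N -> a =1 b.
Proof.
elim: n a b => [a b _ _ _ []//|n IH a b ha hb].
have D0 : (0 < D)%N by apply: leq_ltn_trans (ha ord0).
have E (f : 'I_n.+1 -> nat) : (\sum_i f i * D ^ i =
    (\sum_(i < n) f (lift ord0 i) * D ^ i) * D + f ord0)%N.
  rewrite big_ord_recl expn0 muln1 addnC; congr addn; rewrite big_distrl /=.
  by apply: eq_bigr => i _; rewrite /bump /= add1n expnSr mulnA.
rewrite !E => eab i.
have ab0 : a ord0 = b ord0.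
  have := congr1 (modn^~ D) eab.
  by rewrite /= !modnMDl !modn_small.
have [j ->|->//] := unliftP ord0 i.
apply: (IH (fun j => a (lift ord0 j)) (fun j => b (lift ord0 j))) => //.
move/eqP: eab; rewrite ab0 eqn_add2r eqn_pmul2r // => /eqP//.
Qed.

(** Along the curve with coordinates [s ^ (D ^ i)], where [D] exceeds the degree
    of [F], distinct monomials of [F] get distinct exponents, so the claim
    reduces to one variable. *)
Lemma mpoly_vanishing F :
  (forall v : 'I_N -> k, (forall i, v i != 0) -> F.@[v] = 0) -> F = 0.
Proof.
move=> hF; pose D := msize F; pose c (i : 'I_N) : {poly k} := 'X^(D ^ i).
have F0 : along F c = 0.
  apply: poly_vanishing => s s0; rewrite along_horner; apply: hF => i.
  by rewrite hornerXn expf_neq0.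
have Dm m : m \in msupp F -> forall i, (m i < D)%N.
  move=> /msize_mdeg_lt mD i; apply: leq_ltn_trans mD.
  by rewrite mdegE (bigD1 i) //= leq_addr.
apply/mpolyP => m; rewrite mcoeff0.
have [mF|/memN_msupp_eq0//] := boolP (m \in msupp F).
have := congr1 (fun P : {poly k} => P`_(\sum_i m i * D ^ i)) F0.
rewrite coef0 /along /mmap coef_sum (bigD1_seq m) ?msupp_uniq //=.
have E m' : mmap1 c m' = 'X^(\sum_i m' i * D ^ i).
  rewrite /mmap1 -prodrXr; apply: eq_bigr => i _.
  by rewrite /c -exprM mulnC.
rewrite E coefCM coefXn eqxx mulr1 big_seq_cond big1 ?addr0 // => m' /andP[m'F mm'].
rewrite E coefCM coefXn; case: eqP => [e|_]; last by rewrite mulr0.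
case/eqP: mm'; apply/mnmP => i; apply: (@base_expansion_inj D) i; by [apply: Dm|].
Qed.

End PolynomialCurves.

(** * Sets parametrized by monomials *)

Section MonomialParametrization.
Variables (k : closedFieldType) (N m : nat).
Variables (x : 'rV[k]_N.+1) (D : 'I_N.+1 -> 'I_m -> int).
Implicit Types (F : {mpoly k[N.+1]}) (tau : 'I_m -> k).

Definition mono_pt tau : 'rV[k]_N.+1 :=
  \row_j (x 0 j * \prod_i tau i ^ D j i).

Definition mono_set : set 'rV[k]_N.+1 :=
  [set y | exists tau, (forall i, tau i != 0) /\ y = mono_pt tau].

(** Adding [S] to all exponents makes them nonnegative; this multiplies every
    coordinate by the same unit, which homogeneous equations ignore. *)
Let S : nat := (\sum_j \sum_i `|D j i|)%N.

Let SD j i : (0 <= D j i + S%:Z).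
Proof.
have : (`|D j i| <= S)%N by rewrite /S (bigD1 j) //= (bigD1 i) //= -addnA leq_addr.
by lia.
Qed.

Let shifted_exponent (a : k) j i : a != 0 ->
  a ^ D j i * a ^+ S = a ^+ `|(D j i + S%:Z)%R|%N.
Proof. by move=> a0; rewrite !exprnP gez0_abs ?SD // -expfzDr. Qed.

Lemma mono_curve (P : 'I_m -> {poly k}) F : homogeneous F ->
  exists (Q : {poly k}), forall s, (forall i, (P i).[s] != 0) ->
    (Q.[s] = 0 <-> F.@[mono_pt (fun i => (P i).[s]) 0] = 0).
Proof.
move=> [e hF].
pose c (j : 'I_N.+1) := x 0 j *: \prod_i (P i) ^+ `|(D j i + S%:Z)%R|%N.
exists (along F c) => s Ps; rewrite along_horner.
have -> : F.@[fun j => (c j).[s]] =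
    (\prod_i (P i).[s] ^+ S) ^+ e * F.@[mono_pt (fun i => (P i).[s]) 0].
  rewrite -(mevalZ_homog _ _ hF); apply: meval_eq => j.
  rewrite /c hornerZ horner_prod mxE mulrCA; congr (_ * _).
  rewrite -big_split /=; apply: eq_bigr => i _.
  by rewrite horner_exp mulrC shifted_exponent.
have nz : (\prod_i (P i).[s] ^+ S) ^+ e != 0.
  by rewrite expf_neq0 // prodf_seq_neq0; apply/allP => i _; rewrite expf_neq0.
split=> [/eqP|->]; last by rewrite mulr0.
by rewrite mulf_eq0 (negPf nz) => /eqP.
Qed.

(** Two points of the parameter torus are joined by a line, so it suffices that
    a product of nonzero polynomials in one variable is nonzero. *)
Lemma mono_set_irreducible : x != 0 -> irreducible_set mono_set.
Proof.
move=> x0; split.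
  by exists (mono_pt (fun=> 1)), (fun=> 1); split=> // i; rewrite oner_neq0.
move=> Z1 Z2 /zariski_closedP[I1 [h1 ->]] /zariski_closedP[I2 [h2 ->]] SZ.
have S0 y : mono_set y -> y != 0 by move=> /SZ[[]|[]].
have bad (I : set {mpoly k[N.+1]}) : ~ mono_set `<=` zero_locus I ->
    exists F tau, [/\ I F, forall i, tau i != 0 & F.@[mono_pt tau 0] <> 0].
  move=> /existsNP[y /not_implyP[Sy]]; move: (Sy) => [tau [t0 ->]] /not_andP[].
    by move=> []; apply: S0; exists tau.
  by move=> /existsNP[F /not_implyP[IF nF]]; exists F, tau.
apply: contrapT => /not_orP[/bad[F1 [t1 [i1 u1 n1]]] /bad[F2 [t2 [i2 u2 n2]]]].
pose P i : {poly k} := (t1 i)%:P + (t2 i - t1 i) *: 'X.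
have P0 i : (P i).[0] = t1 i by rewrite hornerD hornerC hornerZ hornerX mulr0 addr0.
have P1 i : (P i).[1] = t2 i by rewrite hornerD hornerC hornerZ hornerX mulr1 addrC subrK.
have [Q1 hQ1] := mono_curve P (h1 _ i1).
have [Q2 hQ2] := mono_curve P (h2 _ i2).
have E1 : (fun i => (P i).[0]) = t1 by apply/funext.
have E2 : (fun i => (P i).[1]) = t2 by apply/funext.
have /poly_nonvanishing[s _] : Q1 * Q2 * \prod_i P i != 0.
  rewrite !mulf_neq0 //.
  - apply: contra_not_neq n1 => Q10; rewrite -E1; apply/hQ1 => [i|].
      by rewrite P0.
    by rewrite Q10 horner0.
  - apply: contra_not_neq n2 => Q20; rewrite -E2; apply/hQ2 => [i|].
      by rewrite P1.
    by rewrite Q20 horner0.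
  rewrite prodf_seq_neq0; apply/allP => i _ /=.
  by apply: contraNneq (u1 i) => Pi0; rewrite -P0 Pi0 horner0.
rewrite !hornerM horner_prod !mulf_eq0 !negb_or prodf_seq_neq0.
case/andP=> /andP[/eqP Q1s /eqP Q2s] /allP Ps.
have {}Ps i : (P i).[s] != 0 by apply: Ps; rewrite mem_index_enum.
have [[_ h]|[_ h]] := SZ _ (ex_intro _ (fun i => (P i).[s]) (conj Ps erefl)).
  by apply: Q1s; apply/(hQ1 s Ps)/h.
by apply: Q2s; apply/(hQ2 s Ps)/h.
Qed.

End MonomialParametrization.

(** * Tangent vectors of monomial curves *)

Section LogarithmicTangents.
Variables (k : closedFieldType) (N : nat).
Implicit Types (F : {mpoly k[N]}) (y : 'I_N -> k).

(** Differentiate [F] along the curve at [s = 1]. *)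
Lemma nat_curve_tangent F y (la : 'I_N -> nat) :
  (forall s, s != 0 -> F.@[fun j => y j * s ^+ la j] = 0) ->
  \sum_j F^`M(j).@[y] * (y j * (la j)%:R) = 0.
Proof.
move=> hF; pose c j : {poly k} := y j *: 'X^(la j).
have c1 : (fun j => (c j).[1]) = y.
  by apply/funext => j; rewrite hornerZ hornerXn expr1n mulr1.
have : along F c = 0.
  apply: poly_vanishing => s /hF Fs; rewrite along_horner -[RHS]Fs; apply: meval_eq => j.
  by rewrite hornerZ hornerXn.
move=> /(congr1 (fun P => P^`().[1])); rewrite /= deriv0 horner0 along_deriv.
rewrite horner_sum => h; rewrite -[RHS]h; apply: eq_bigr => j _.
rewrite hornerM along_horner c1; congr (_ * _).
by rewrite /c derivZ derivXn hornerZ hornerMn hornerXn expr1n.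
Qed.

(** After a shift of the exponents by [S] the curve is polynomial. The shift adds
    to the tangent vector a multiple of [y], the tangent vector of the line
    through [y], on which [F] vanishes too by homogeneity. *)
Lemma int_curve_tangent e F y (la : 'I_N -> int) : F \is e.-homog ->
  (forall s, s != 0 -> F.@[fun j => y j * s ^ la j] = 0) ->
  \sum_j F^`M(j).@[y] * (y j * (la j)%:~R) = 0.
Proof.
move=> hF Fla; pose S := (\sum_j `|la j|)%N.
have laS j : 0 <= la j + S%:Z.
  have : (`|la j| <= S)%N by rewrite /S (bigD1 j) //= leq_addr.
  by lia.
have Fy : F.@[y] = 0.
  rewrite -(Fla 1 (oner_neq0 _)); apply: meval_eq => j.
  by rewrite exp1rz mulr1.
have shift : \sum_j F^`M(j).@[y] * (y j * (`|(la j + S%:Z)%R|%N)%:R) = 0.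
  apply: nat_curve_tangent => s s0.
  transitivity ((s ^+ S) ^+ e * F.@[fun j => y j * s ^ la j]).
    rewrite -(mevalZ_homog _ _ hF); apply: meval_eq => j.
    by rewrite mulrCA !exprnP gez0_abs // expfzDr // [s ^ S * _]mulrC.
  by rewrite Fla // mulr0.
have euler : \sum_j F^`M(j).@[y] * (y j * S%:R) = 0.
  apply: (nat_curve_tangent (la := fun=> S)) => s _.
  transitivity ((s ^+ S) ^+ e * F.@[y]); last by rewrite Fy mulr0.
  by rewrite -(mevalZ_homog _ _ hF); apply: meval_eq => j; rewrite mulrC.
rewrite -[RHS](subrr (0 : k)) -[X in _ = X - _]shift -[X in _ = _ - X]euler -sumrB.
apply: eq_bigr => j _; rewrite -!mulrBr; congr (_ * (_ * _)).
by rewrite [X in _ = X - _]pmulrn gez0_abs // intrD addrK.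
Qed.

End LogarithmicTangents.

(** * Algebraic dependence of n + 1 polynomials in n variables *)

Section AlgebraicDependence.
Variables (k : closedFieldType) (n : nat).
Implicit Types (p q g : {mpoly k[n]}).

Let deg_le (d : nat) p := (msize p <= d.+1)%N.

Let deg_leM d e p q : deg_le d p -> deg_le e q -> deg_le (d + e) (p * q).
Proof.
rewrite /deg_le; have [->|p0] := eqVneq p 0; first by rewrite mul0r msize0.
have [->|q0] := eqVneq q 0; first by rewrite mulr0 msize0.
rewrite msizeM // => hp hq; rewrite -subn1 leq_subLR add1n -addSn -addnS.
exact: leq_add hp hq.
Qed.

Let deg_leX d p a : deg_le d p -> deg_le (a * d) (p ^+ a).
Proof.
move=> hp; elim: a => [|a IH]; first by rewrite expr0 /deg_le msize1.
by rewrite exprS mulSn; apply: deg_leM.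
Qed.

(** Counting: the [(d + 1) ^ (n + 1)] products on the left have all exponents
    below [B], which is linear in [d], so for large [d] they are more numerous
    than the [B ^ n] monomials available. The power of [g] makes the relation
    homogeneous. *)
Lemma algebraic_dependence (f : 'I_n.+1 -> {mpoly k[n]}) g :
  exists d (c : {ffun 'I_n.+1 -> 'I_d.+1} -> k), (exists a, c a != 0) /\
    \sum_a c a *: (\prod_i f i ^+ a i * g ^+ (n.+1 * d - \sum_i a i)) = 0.
Proof.
pose E := (msize g + \sum_i msize (f i))%N.
have gE : deg_le E g by rewrite /deg_le /E; lia.
have fE i : deg_le E (f i) by rewrite /deg_le /E (bigD1 i) //=; lia.
(* [B <= d.+1 * K], and [d] is chosen such that [K ^ n < d.+1] *)
pose K := (n.+1 * E).+1; pose d := (K ^ n)%N; pose B := (n.+1 * d * E).+1.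
exists d; pose T := {ffun 'I_n.+1 -> 'I_d.+1}.
pose Q (a : T) := \prod_i f i ^+ a i * g ^+ (n.+1 * d - \sum_i a i).
have sum_le (a : T) : (\sum_i a i <= n.+1 * d)%N.
  apply: leq_trans (_ : \sum_(i < n.+1) d <= _)%N; last first.
    by rewrite sum_nat_const card_ord.
  by apply: leq_sum => i _; rewrite -ltnS.
have degQ a : deg_le (n.+1 * d * E) (Q a).
  have -> : (n.+1 * d * E = (\sum_i a i) * E + (n.+1 * d - \sum_i a i) * E)%N.
    by rewrite -mulnDl subnKC.
  apply: deg_leM; last exact: deg_leX.
  elim/big_rec2: _ => [|i x y _ h]; first by rewrite /deg_le msize1.
  by rewrite mulnDl; apply: deg_leM h; apply: deg_leX.
pose mon (b : {ffun 'I_n -> 'I_B}) : 'X_{1..n} := [multinom (b i : nat) | i < n].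
pose M : 'M[k]_(#|{: T}|, #|{: {ffun 'I_n -> 'I_B}}|) :=
  \matrix_(i, j) (Q (enum_val i))@_(mon (enum_val j)).
have cards : (#|{: {ffun 'I_n -> 'I_B}}| < #|{: T}|)%N.
  rewrite !card_ffun !card_ord.
  apply: leq_ltn_trans (_ : (d.+1 * K) ^ n < _)%N.
    by have [->|n0] := posnP n; rewrite ?expn0 // leq_exp2r // /B /K; lia.
  by rewrite expnMn [X in (_ < X)%N]expnSr ltn_pmul2l ?expn_gt0.
have /rowV0Pn[v vK v0] : kermx M != 0.
  rewrite -mxrank_eq0 mxrank_ker -lt0n subn_gt0.
  exact: leq_ltn_trans (rank_leq_col M) cards.
pose c (a : T) := v 0 (enum_rank a); exists c; split.
  by have /rV0Pn[i vi] := v0; exists (enum_val i); rewrite /c enum_valK.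
apply/mpolyP => m; rewrite mcoeff0 raddf_sum /=.
under eq_bigr do rewrite mcoeffZ.
have [/forallP mB|/forallPn[i miB]] := boolP [forall i, m i < B]%N; last first.
  apply: big1 => a _; rewrite [X in _ * X]memN_msupp_eq0 ?mulr0 //.
  apply: msize_mdeg_ge; apply: leq_trans (degQ a) _.
  rewrite -leqNgt in miB; apply: leq_trans miB _.
  by rewrite mdegE (bigD1 i) //= leq_addr.
pose b : {ffun 'I_n -> 'I_B} := [ffun i => Ordinal (mB i)].
have -> : m = mon b by apply/mnmP => i; rewrite mnmE ffunE.
have := congr1 (fun u : 'M_(_, _) => u 0 (enum_rank b)) (sub_kermxP vK).
rewrite !mxE (reindex_onto enum_rank enum_val) => [|a _]; last exact: enum_valK.
move=> h; rewrite -[RHS]h; apply: eq_big => [a|a _]; first by rewrite enum_rankK eqxx.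
by rewrite mxE !enum_rankK.
Qed.

End AlgebraicDependence.

(** * Directional and logarithmic derivatives *)

Section DirectionalDerivative.
Variables (k : closedFieldType) (N : nat) (x v : 'I_N -> k).
Implicit Types (F G : {mpoly k[N]}).

Definition dir_deriv F : k := \sum_j F^`M(j).@[x] * v j.

Definition has_log_deriv F (L : k) := dir_deriv F = F.@[x] * L.

Lemma dir_derivB F G : dir_deriv (F - G) = dir_deriv F - dir_deriv G.
Proof.
rewrite /dir_deriv -sumrB; apply: eq_bigr => j _.
by rewrite mderivB mevalB mulrBl.
Qed.

Lemma log_deriv1 : has_log_deriv 1 0.
Proof.
rewrite /has_log_deriv mulr0; apply: big1 => j _.
by rewrite (mderivC j 1) meval0 mul0r.
Qed.

Lemma log_derivM F G L M :
  has_log_deriv F L -> has_log_deriv G M -> has_log_deriv (F * G) (L + M).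
Proof.
move=> hF hG; rewrite /has_log_deriv mevalM.
transitivity (dir_deriv F * G.@[x] + F.@[x] * dir_deriv G).
  rewrite /dir_deriv mulr_suml mulr_sumr -big_split; apply: eq_bigr => j _ /=.
  by rewrite mderivM mevalD !mevalM mulrDl mulrA; congr (_ + _); rewrite mulrAC.
by rewrite hF hG; ring.
Qed.

Lemma log_derivX F L e : has_log_deriv F L -> has_log_deriv (F ^+ e) (e%:R * L).
Proof.
move=> hF; elim: e => [|e IH]; first by rewrite mul0r; exact: log_deriv1.
by rewrite exprS (_ : e.+1%:R * L = L + e%:R * L); [exact: log_derivM|rewrite -natr1; ring].
Qed.

Lemma log_deriv_prod (I : finType) (F : I -> {mpoly k[N]}) L :
  (forall i, has_log_deriv (F i) (L i)) -> has_log_deriv (\prod_i F i) (\sum_i L i).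
Proof.
move=> hF; elim/big_rec2: _ => [|i M G _]; first exact: log_deriv1.
exact: log_derivM.
Qed.

Lemma log_derivU i : x i != 0 -> has_log_deriv 'X_i (v i / x i).
Proof.
move=> xi; rewrite /has_log_deriv mevalXU mulrC divfK // /dir_deriv (bigD1 i) //=.
rewrite big1 => [|j ji]; last by rewrite mderivU eq_sym (negPf ji) meval0 mul0r.
by rewrite mderivU eqxx meval1 mul1r addr0.
Qed.

End DirectionalDerivative.

Definition pos_part (z : int) : nat := if z is Posz m then m else 0%N.
Definition neg_part (z : int) : nat := if z is Negz m then m.+1 else 0%N.

Lemma pos_neg_part z : z = (pos_part z)%:Z - (neg_part z)%:Z.
Proof. by case: z => m /=; rewrite ?subr0 ?sub0r. Qed.

Lemma exprz_parts (k : fieldType) (a : k) z : a != 0 ->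
  a ^ z * a ^+ neg_part z = a ^+ pos_part z.
Proof.
by move=> a0; rewrite !exprnP -expfzDr //; congr (_ ^ _); case: z => m /=; lia.
Qed.

(** * Toric varieties in barycentric coordinates *)

(** The points of [A] are given by integer coordinates [bary j] of sum [1] with
    respect to the affine basis formed by the first [n + 1] of them, so that
    [bary j] are the coordinates of [(1, u_j)] in a basis of [Z^(n+1)]. A point
    of the torus orbit is then determined by its first [n + 1] coordinates,
    which are arbitrary nonzero scalars. *)
Section ToricVariety.
Variables (k : closedFieldType) (n N : nat) (hnN : (n.+1 <= N.+1)%N).
Variable bary : 'I_N.+1 -> 'I_n.+1 -> int.
Let io (b : 'I_n.+1) : 'I_N.+1 := widen_ord hnN b.
Hypothesis bary_basis : forall b b', bary (io b) b' = (b == b')%:R.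
Hypothesis bary_sum : forall j, \sum_b bary j b = 1.
Implicit Types (F : {mpoly k[N.+1]}) (x y : 'rV[k]_N.+1) (tau : 'I_n.+1 -> k).

Definition torus_pt tau : 'rV[k]_N.+1 := mono_pt (const_mx 1) bary tau.
Definition torus_orbit : set 'rV[k]_N.+1 := mono_set (const_mx 1) bary.
Definition torus_closure := zariski_closure torus_orbit.
Local Notation O := torus_orbit.
Local Notation X := torus_closure.

Lemma torus_ptE tau j : torus_pt tau 0 j = \prod_b tau b ^ bary j b.
Proof. by rewrite !mxE mul1r. Qed.

Lemma torus_pt_neq0 tau j : (forall b, tau b != 0) -> torus_pt tau 0 j != 0.
Proof.
move=> t0; rewrite torus_ptE prodf_seq_neq0; apply/allP => b _ /=.
by rewrite expfz_neq0.
Qed.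

Lemma torus_pt_basis tau b : torus_pt tau 0 (io b) = tau b.
Proof.
rewrite torus_ptE (bigD1 b) //= bary_basis eqxx big1 ?mulr1 // => b' bb'.
by rewrite bary_basis eq_sym (negPf bb').
Qed.

Lemma torus_ptM s tau j :
  torus_pt (fun b => s b * tau b) 0 j = torus_pt s 0 j * torus_pt tau 0 j.
Proof.
rewrite !torus_ptE -big_split; apply: eq_bigr => b _.
by rewrite expfzMl.
Qed.

Lemma torus_pt_scale a tau j : a != 0 ->
  torus_pt (fun b => a * tau b) 0 j = a * torus_pt tau 0 j.
Proof.
move=> a0; rewrite torus_ptM; congr (_ * _); rewrite torus_ptE.
transitivity (a ^ (\sum_b bary j b)); last by rewrite bary_sum.
by rewrite (big_morph _ (fun z t => expfzDr z t a0) (expr0z a)).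
Qed.

Lemma bary_sumr j : \sum_b (bary j b)%:~R = 1 :> k.
Proof.
have := congr1 (fun z => z%:~R : k) (bary_sum j).
by rewrite /= (big_morph intr (@intrD k) (erefl _)).
Qed.

Lemma orbit_neq0 x : O x -> forall j, x 0 j != 0.
Proof. by move=> [tau [t0 ->]] j; apply: torus_pt_neq0. Qed.

Lemma orbit_nonzero : nonzero_set O.
Proof.
move=> x /orbit_neq0/(_ ord0) x0; apply: contraNneq x0 => ->.
by rewrite mxE.
Qed.

Lemma sub_orbit_closure : O `<=` X. Proof. exact: sub_closure. Qed.

(** The torus acts on the orbit by diagonal matrices, hence on its closure. *)
Lemma closure_torus_action y s : (forall b, s b != 0) -> X y ->
  X (\row_j (y 0 j * torus_pt s 0 j)).
Proof.
move=> s0 /(closureP _ orbit_nonzero)[y0 hy]; pose J := diag_mx (torus_pt s).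
have yJ (z : 'rV_N.+1) : \row_j (z 0 j * torus_pt s 0 j) = z *m J.
  by apply/rowP => j; rewrite mul_mx_diag !mxE.
apply/(closureP _ orbit_nonzero); split.
  apply: contraNneq y0 => h; apply/eqP/rowP => j.
  have := congr1 (fun u : 'rV_ _ => u 0 j) h; rewrite /= [LHS]mxE [RHS]mxE => /eqP.
  by rewrite mulf_eq0 (negPf (torus_pt_neq0 j s0)) orbF mxE => /eqP.
move=> F hF vF; rewrite yJ -lin_pullE; apply: hy; first exact: lin_pull_homog.
move=> _ [tau [t0 ->]]; rewrite lin_pullE -yJ; apply: vF.
exists (fun b => tau b * s b); split=> [b|]; first by rewrite mulf_neq0.
by apply/rowP => j; rewrite [RHS]torus_ptM mxE.
Qed.

(** ** Binomial equations *)

(** The equation [x_j = prod_b x_b ^ bary j b] of the orbit, with the negative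
    exponents moved to the left; [bary_sum] makes it homogeneous. *)
Definition binomial_l j : {mpoly k[N.+1]} :=
  'X_j * \prod_b 'X_(io b) ^+ neg_part (bary j b).
Definition binomial_r j : {mpoly k[N.+1]} :=
  \prod_b 'X_(io b) ^+ pos_part (bary j b).

Lemma binomial_homog j : homogeneous (binomial_l j - binomial_r j).
Proof.
exists (\sum_b pos_part (bary j b))%N; rewrite rpredB //; last exact: prod_vars_homog.
have -> : (\sum_b pos_part (bary j b) = 1 + \sum_b neg_part (bary j b))%N.
  have := bary_sum j; rewrite (eq_bigr _ (fun b _ => pos_neg_part (bary j b))).
  rewrite sumrB -!(big_morph Posz PoszD (erefl _)) => /eqP.
  by rewrite subr_eq -PoszD => /eqP[].
by apply: dhomogM (prod_vars_homog _ _ _); rewrite dhomogX; apply/eqP/mdeg1.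
Qed.

Lemma orbit_binomial j : vanishes_on (binomial_l j - binomial_r j) O.
Proof.
move=> _ [tau [t0 ->]]; apply/eqP; rewrite mevalB subr_eq0; apply/eqP.
rewrite /binomial_l mevalM mevalXU !prod_vars_eval -/(torus_pt tau) torus_ptE -big_split.
apply: eq_bigr => b _ /=.
by rewrite -/(torus_pt tau) torus_pt_basis exprz_parts.
Qed.

Lemma closure_binomial y j : X y -> (binomial_l j).@[y 0] = (binomial_r j).@[y 0].
Proof.
move=> Xy; apply/eqP; rewrite -subr_eq0 -mevalB; apply/eqP.
exact: (closure_vanishing (binomial_homog j) orbit_nonzero (@orbit_binomial j)).
Qed.

Lemma closure_binomialE y j : X y ->
  y 0 j * \prod_b y 0 (io b) ^+ neg_part (bary j b) =
  \prod_b y 0 (io b) ^+ pos_part (bary j b).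
Proof. by move=> /(closure_binomial j); rewrite mevalM mevalXU !prod_vars_eval. Qed.

Lemma orbit_of_basis y : (forall b, y 0 (io b) != 0) ->
  (forall j, y 0 j = \prod_b y 0 (io b) ^ bary j b) -> O y.
Proof.
move=> y0 hy; exists (fun b => y 0 (io b)); split=> //.
by apply/rowP => j; rewrite -/(torus_pt _) torus_ptE.
Qed.

(** The binomial equation can be solved for [y_j] as soon as the coordinates that
    occur in it do not vanish; the other coordinates may be zero. *)
Lemma closure_basisE y j : X y -> (forall b, bary j b != 0 -> y 0 (io b) != 0) ->
  y 0 j = \prod_b y 0 (io b) ^ bary j b.
Proof.
move=> Xy y0; have := closure_binomialE j Xy.
have nz : \prod_b y 0 (io b) ^+ neg_part (bary j b) != 0.
  rewrite prodf_seq_neq0; apply/allP => b _ /=.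
  by have [->|/y0 yb] := eqVneq (bary j b) 0; rewrite ?oner_neq0 ?expf_neq0.
move=> h; apply: (mulIf nz); rewrite h -big_split; apply: eq_bigr => b _ /=.
have [->|/y0 yb] := eqVneq (bary j b) 0; first by rewrite mulr1.
by rewrite exprz_parts.
Qed.

Lemma closure_orbit y : X y -> (forall j, y 0 j != 0) -> O y.
Proof. by move=> Xy y0; apply: orbit_of_basis => // j; apply: closure_basisE. Qed.

(** ** Tangent spaces *)

Definition frame_mx y : 'M[k]_(n.+1, N.+1) := \matrix_(b, j) ((bary j b)%:~R * y 0 j).

Lemma frame_mxE (phi : 'rV[k]_n.+1) y j :
  (phi *m frame_mx y) 0 j = (\sum_b phi 0 b * (bary j b)%:~R) * y 0 j.
Proof.
by rewrite mxE mulr_suml; apply: eq_bigr => b _; rewrite mxE mulrA.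
Qed.

Lemma frame_mx_basis (phi : 'rV[k]_n.+1) y b :
  (phi *m frame_mx y) 0 (io b) = phi 0 b * y 0 (io b).
Proof.
rewrite frame_mxE (bigD1 b) //= bary_basis eqxx mulr1 big1 ?addr0 // => b' bb'.
by rewrite bary_basis eq_sym (negPf bb') mulr0.
Qed.

Lemma frame_mx_free y : (forall b, y 0 (io b) != 0) -> row_free (frame_mx y).
Proof.
move=> y0; apply/row_freeP.
exists (\matrix_(j, b) ((j == io b)%:R / y 0 (io b))); apply/matrixP => b b'.
rewrite !mxE (bigD1 (io b')) //= !mxE eqxx mul1r mulfK // bary_basis.
rewrite big1 ?addr0 => [|j ji]; last by rewrite !mxE (negPf ji) mul0r mulr0.
by rewrite eq_sym; case: (b == b').
Qed.

(** This holds at all points of the closure: the row of index [b] is tangent to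
    the orbit of [y] under the one-parameter subgroup that scales the basis
    coordinate [b]. *)
Lemma frame_sub_tangent y : X y ->
  row_space (frame_mx y) `<=` embedded_tangent_space X y.
Proof.
move=> Xy v /= /submxP[phi ->] F [e hF] vF.
transitivity (\sum_b phi 0 b * \sum_j F^`M(j).@[y 0] * (y 0 j * (bary j b)%:~R)).
  under [RHS]eq_bigr do rewrite mulr_sumr.
  rewrite exchange_big /=; apply: eq_bigr => j _; rewrite frame_mxE mulr_suml mulr_sumr.
  by apply: eq_bigr => b _; ring.
apply: big1 => b _; rewrite (int_curve_tangent hF) ?mulr0 // => s s0.
pose sb b' := if b' == b then s else 1.
have sb0 b' : sb b' != 0 by rewrite /sb; case: ifP; rewrite ?oner_neq0.
have := vF _ (closure_torus_action sb0 Xy).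
move=> h; rewrite -[RHS]h; apply: meval_eq => j; rewrite mxE torus_ptE (bigD1 b) //= /sb eqxx.
by rewrite big1 ?mulr1 // => b' /negPf->; rewrite exp1rz.
Qed.

(** The logarithmic derivative of the binomial equation of index [j] expresses
    [v_j / x_j] by the [v_b / x_b] with [b] in the basis. *)
Lemma tangent_sub_frame x : O x ->
  embedded_tangent_space X x `<=` row_space (frame_mx x).
Proof.
move=> Ox v Tv; have x0 := orbit_neq0 Ox; have Xx := sub_orbit_closure Ox.
apply/submxP; exists (\row_b (v 0 (io b) / x 0 (io b))); apply/rowP => j.
rewrite frame_mxE; under eq_bigr do rewrite mxE.
pose L e := \sum_b (e b)%:R * (v 0 (io b) / x 0 (io b)) : k.
have log_prod e : has_log_deriv (x 0) (v 0) (\prod_b 'X_(io b) ^+ e b) (L e).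
  by apply: log_deriv_prod => b; apply: log_derivX; apply: log_derivU.
have hl : has_log_deriv (x 0) (v 0) (binomial_l j)
    (v 0 j / x 0 j + L (fun b => neg_part (bary j b))).
  exact: log_derivM (log_derivU _ (x0 j)) (log_prod _).
have hr : has_log_deriv (x 0) (v 0) (binomial_r j) (L (fun b => pos_part (bary j b))).
  exact: log_prod.
have nz : (binomial_r j).@[x 0] != 0.
  by rewrite prod_vars_eval prodf_seq_neq0; apply/allP => b _; rewrite expf_neq0.
have := Tv _ (binomial_homog j) (closure_vanishing (binomial_homog j)
  orbit_nonzero (@orbit_binomial j)).
move/eqP; rewrite -/(dir_deriv _ _ _) dir_derivB hl hr (closure_binomial j Xx).
rewrite subr_eq0 => /eqP/(mulfI nz) e; rewrite -[LHS](divfK (x0 j)); congr (_ * _).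
apply: (addIr (L (fun b => neg_part (bary j b)))); rewrite {}e -big_split /=.
apply: eq_bigr => b _; rewrite [X in X + _]mulrC -mulrDl; congr (_ * _).
by rewrite [in X in X + _](pos_neg_part (bary j b)) intrB -!pmulrn subrK.
Qed.

Lemma tangent_orbit x : O x ->
  embedded_tangent_space X x = row_space (frame_mx x).
Proof.
move=> Ox; apply/seteqP; split; first exact: tangent_sub_frame.
by apply: frame_sub_tangent; apply: sub_orbit_closure.
Qed.

(** ** Dimension *)

(** The chart [tau_0 = 1] of the orbit, whose coordinate functions are the
    ratios of basis coordinates. *)
Let tail (b : 'I_n) : 'I_n.+1 := lift ord0 b.

Let chart (v : 'I_n -> k) (b : 'I_n.+1) : k := if unlift ord0 b is Some i then v i else 1.

Let chart_neq0 v : (forall i, v i != 0) -> forall b, chart v b != 0.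
Proof. by move=> v0 b; rewrite /chart; case: unliftP => [i|] _; rewrite ?oner_neq0. Qed.

(** The coordinates of [chart] are independent. Conversely, [n + 1] rational
    functions with a common denominator pull back along [chart] to polynomials
    in [n] variables, up to a monomial factor that homogeneity absorbs; a
    homogeneous relation between these holds on the orbit, hence on [X]. *)
Lemma torus_closure_dimension : has_dimension X n.
Proof.
split.
  exists (fun i => 'X_(io (tail i))), ('X_(io ord0)); split.
  - by exists 1%N; split=> [|i]; rewrite dhomogX; apply/eqP/mdeg1.
  - pose o := torus_pt (fun=> 1).
    have Oo : O o by exists (fun=> 1); split=> // b; rewrite oner_neq0.
    move=> /(_ o (sub_orbit_closure Oo)); rewrite mevalXU => /eqP.
    by rewrite (negPf (orbit_neq0 Oo _)).
  move=> P hP; apply: mpoly_vanishing => v v0.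
  have Ov : O (torus_pt (chart v)).
    by exists (chart v); split=> //; apply: chart_neq0.
  have := hP _ (sub_orbit_closure Ov).
  rewrite mevalXU orbit_neq0 // => /(_ isT) {1}<-; apply: meval_eq => i.
  by rewrite !mevalXU !torus_pt_basis /chart liftK unlift_none divr1.
case=> f [g [[e [hg hf]] ng indep]].
pose S := (\sum_j \sum_b `|bary j b|)%N.
have btS j b : 0 <= bary j b + S%:Z.
  have : (`|bary j b| <= S)%N by rewrite /S (bigD1 j) //= (bigD1 b) //= -addnA leq_addr.
  by lia.
pose q j : {mpoly k[n]} := \prod_i 'X_i ^+ `|(bary j (tail i) + S%:Z)%R|%N.
pose pull F := F \mPo [tuple q j | j < N.+1].
have pullE d F v : F \is d.-homog -> (forall i, v i != 0) ->
    (pull F).@[v] = ((\prod_i v i) ^+ S) ^+ d * F.@[torus_pt (chart v) 0].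
  move=> hF v0; rewrite /pull comp_mpoly_meval -(mevalZ_homog _ _ hF).
  apply: meval_eq => j; rewrite tnth_mktuple torus_ptE big_ord_recl /chart unlift_none.
  rewrite exp1rz mul1r -prodrXl -big_split /q rmorph_prod; apply: eq_bigr => i _ /=.
  by rewrite liftK rmorphXn /= mevalXU !exprnP gez0_abs // expfzDr // mulrC.
have [d [c [[a0 ca0] rel]]] := algebraic_dependence (fun i => pull (f i)) (pull g).
pose ex (a : {ffun 'I_n.+1 -> 'I_d.+1}) := (n.+1 * d - \sum_i a i)%N.
pose G : {mpoly k[N.+1]} := \sum_a c a *: (\prod_i f i ^+ a i * g ^+ ex a).
have exE (a : {ffun 'I_n.+1 -> 'I_d.+1}) : (\sum_i a i + ex a = n.+1 * d)%N.
  rewrite /ex subnKC //; apply: leq_trans (_ : \sum_(i < n.+1) d <= _)%N; last first.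
    by rewrite sum_nat_const card_ord.
  by apply: leq_sum => i _; rewrite -ltnS.
have hG : G \is (e * (n.+1 * d)).-homog.
  apply: rpred_sum => a _; rewrite rpredZ // -(exE a) mulnDr.
  apply: dhomogM; last exact: dhomogMn.
  elim/big_rec2: _ => [|i m P _ hP]; first by rewrite muln0; exact: dhomog1.
  by rewrite mulnDr; apply: dhomogM hP; apply: dhomogMn.
have HG : homogeneous G by exists (e * (n.+1 * d))%N.
have pullG : pull G = 0.
  rewrite -[RHS]rel /pull raddf_sum; apply: eq_bigr => a _ /=.
  rewrite comp_mpolyZ rmorphM rmorph_prod rmorphXn /=; congr (_ *: (_ * _)).
  by apply: eq_bigr => i _; rewrite rmorphXn.
have vG : vanishes_on G O.
  move=> _ [tau [t0 ->]]; pose v i := tau (tail i) / tau ord0.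
  have v0 i : v i != 0 by rewrite mulf_neq0 ?invr_eq0.
  have tauE : tau = fun b => tau ord0 * chart v b.
    apply/funext => b; rewrite /chart; case: unliftP => [i ->|->]; last by rewrite mulr1.
    by rewrite /v mulrC divfK.
  have := pullE _ _ _ hG v0; rewrite pullG meval0 => /esym/eqP.
  rewrite mulf_eq0 expf_eq0 expf_eq0 prodf_seq_eq0.
  rewrite (_ : has _ _ = false) ?andbF /= => [/eqP Gv|]; last first.
    by apply/hasPn => i _; rewrite (negPf (v0 i)).
  rewrite -[mono_pt _ _ _]/(torus_pt tau) tauE.
  rewrite -(mulr0 (tau ord0 ^+ (e * (n.+1 * d)))) -Gv -(mevalZ_homog _ _ hG).
  by apply: meval_eq => j; rewrite torus_pt_scale.
pose mon (a : {ffun 'I_n.+1 -> 'I_d.+1}) := [multinom (a i : nat) | i < n.+1].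
pose P := \sum_a c a *: 'X_[mon a] : {mpoly k[n.+1]}.
have : P = 0.
  apply: indep => x Xx gx; apply: (mulIf (expf_neq0 (n.+1 * d) gx)); rewrite mul0r.
  rewrite -[RHS](closure_vanishing HG orbit_nonzero vG Xx).
  rewrite /P /G !raddf_sum mulr_suml; apply: eq_bigr => a _ /=.
  rewrite !mevalZ -mulrA; congr (_ * _); rewrite mevalX mevalM rmorph_prod rmorphXn /=.
  under eq_bigr do rewrite mnmE expr_div_n.
  rewrite prodf_div prodrXr -(exE a) exprD mulrA divfK ?expf_neq0 //.
  by congr (_ * _); apply: eq_bigr => i _; rewrite rmorphXn.
move/(congr1 (mcoeff (mon a0))); rewrite mcoeff0 raddf_sum /= (bigD1 a0) //=.
rewrite mcoeffZ mcoeffX eqxx mulr1 big1 ?addr0 => [/eqP|a aa0].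
  by rewrite (negPf ca0).
rewrite mcoeffZ mcoeffX; case: eqP => [/mnmP h|_]; last by rewrite mulr0.
case/eqP: aa0; apply/ffunP => i; apply/val_inj.
by have := h i; rewrite !mnmE.
Qed.

Lemma torus_orbit_smooth x : O x -> smooth_point X x.
Proof.
move=> Ox; split; first exact: sub_orbit_closure.
exists n; split; first exact: torus_closure_dimension.
exists (frame_mx x); split; last exact: tangent_orbit.
by apply: frame_mx_free => b; apply: orbit_neq0.
Qed.

(** ** The complement of the orbit is cut out by the coordinates *)

Lemma orbit_complement_closed : exists Z : set 'rV[k]_N.+1,
  zariski_closed Z /\ forall x, X x -> (O x <-> ~ Z x).
Proof.
pose c : {mpoly k[N.+1]} := \prod_j 'X_j ^+ 1.
have cE (x : 'rV_N.+1) : c.@[x 0] = \prod_j x 0 j by rewrite prod_vars_eval.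
have hc : homogeneous c by exists (\sum_(j < N.+1) 1)%N; exact: prod_vars_homog.
exists (zero_locus [set c]); split; first by apply: closed_zero_locus => _ ->.
move=> x Xx; split=> [Ox [_ /(_ c erefl)]|nZ].
  rewrite cE => /eqP; apply/negP; rewrite prodf_seq_neq0.
  by apply/allP => j _; apply: orbit_neq0.
apply: closure_orbit => // j.
apply: contra_notN nZ => /eqP xj; split; first exact: closure_nonzero orbit_nonzero _ Xx.
by move=> _ ->; rewrite cE (bigD1 j) //= xj mul0r.
Qed.

Lemma orbit_nonempty : O !=set0.
Proof.
by exists (torus_pt (fun=> 1)), (fun=> 1); split=> // b; rewrite oner_neq0.
Qed.

Lemma at_general_orbit (P : 'rV[k]_N.+1 -> Prop) :
  (forall x, O x -> P x) -> at_general_point X P.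
Proof.
move=> OP; have [Z [cZ ZO]] := orbit_complement_closed; exists Z; split=> //.
  have [o Oo] := orbit_nonempty; have Xo := sub_orbit_closure Oo.
  by move=> /(_ o Xo); apply/(ZO _ Xo).
by move=> x Xx nZ; apply/OP/(ZO _ Xx).
Qed.

End ToricVariety.

(** * Fibers of the Gauss map *)

(** Dividing an integer vector by its content leaves a vector that is nonzero
    modulo [p]. *)
Lemma divide_out (p : nat) (I : finType) (a : I -> int) : prime p ->
  (exists i, a i != 0) ->
  exists (q : nat) (la : I -> int), [/\ (0 < q)%N, forall i, a i = q%:Z * la i &
    exists i, ~~ (p%:Z %| la i)%Z].
Proof.
move=> pr [i0 ai0]; pose q := \big[gcdn/0%N]_i `|a i|%N.
have qa i : (q %| `|a i|)%N by apply: (biggcdn_inf i).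
have q0 : (0 < q)%N.
  by rewrite lt0n; apply: contraNneq ai0 => q0; have := qa i0; rewrite q0 dvd0n absz_eq0.
have E i : a i = q%:Z * (a i %/ q%:Z)%Z by rewrite mulrC divzK // dvdzE.
exists q, (fun i => (a i %/ q%:Z)%Z); split=> //.
apply: contrapT => h; have : (q * p %| q)%N.
  apply/dvdn_biggcdP => i _; rewrite (E i) abszM dvdn_pmul2l //.
  by apply: contrapT => /negP n; apply: h; exists i; rewrite dvdzE.
by rewrite -[X in (_ %| X)%N]muln1 dvdn_pmul2l // dvdn1 => /eqP p1; rewrite p1 in pr.
Qed.

Lemma closed_field_root (k : closedFieldType) (q : nat) (s : k) : (0 < q)%N ->
  exists a, a ^+ q = s.
Proof.
move=> q0; have /closed_rootP[a] : size ('X^q - s%:P) != 1%N.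
  by rewrite size_XnsubC // eqSS -lt0n.
by rewrite /root !hornerE subr_eq0 => /eqP; exists a.
Qed.

(** The chain rule for [lin_pull] is read off along the line [x + s v]. *)
Section ChainRule.
Variables (k : closedFieldType) (a b : nat).

Let line N (x v : 'rV[k]_N) j : {poly k} := (x 0 j)%:P + v 0 j *: 'X.

Let dir_deriv_line N (x v : 'rV[k]_N) (F : {mpoly k[N]}) :
  dir_deriv (x 0) (v 0) F = (along F (line x v))^`().[0].
Proof.
rewrite along_deriv horner_sum; apply: eq_bigr => j _.
rewrite hornerM along_horner derivD derivC add0r derivZ derivX hornerZ hornerC mulr1.
by congr (_ * _); apply: meval_eq => i; rewrite hornerD hornerC hornerZ hornerX mulr0 addr0.
Qed.

Lemma dir_deriv_lin_pull (J : 'M[k]_(a.+1, b.+1)) F (x v : 'rV[k]_a.+1) :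
  dir_deriv (x 0) (v 0) (lin_pull J F) = dir_deriv ((x *m J) 0) ((v *m J) 0) F.
Proof.
rewrite !dir_deriv_line; congr (_^`().[0]); apply/eqP.
rewrite -subr_eq0; apply/eqP/poly_vanishing => s _; rewrite hornerD hornerN !along_horner.
have E N (y w : 'rV_N) : (fun j => (line y w j).[s]) = (y + s *: w) 0.
  by apply/funext => j; rewrite hornerD hornerC hornerZ hornerX !mxE mulrC.
by rewrite !E lin_pullE mulmxDl scalemxAl subrr.
Qed.

End ChainRule.

(** The points of [in_block] are the basis points of index at most [r] and the
    points outside of the basis; the remaining ones are coloops. The hypotheses
    say that the points of the block do not involve the coloops modulo [p], that
    the block is connected in the matroid modulo [p] ([z] has to agree at a
    point and at the basis points that occur in it), and that some point has
    coefficient [-1] at a basis point of the block. *)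
Section GaussFibers.
Variables (k : closedFieldType) (n N : nat) (hnN : (n.+1 <= N.+1)%N).
Variable bary : 'I_N.+1 -> 'I_n.+1 -> int.
Let io (b : 'I_n.+1) : 'I_N.+1 := widen_ord hnN b.
Hypothesis bary_basis : forall b b', bary (io b) b' = (b == b')%:R.
Hypothesis bary_sum : forall j, \sum_b bary j b = 1.
Implicit Types (F : {mpoly k[N.+1]}) (x y : 'rV[k]_N.+1) (tau : 'I_n.+1 -> k).
Local Notation O := (torus_orbit (k := k) bary).
Local Notation X := (torus_closure (k := k) bary).
Local Notation frame := (frame_mx (k := k) bary).

Variables (p r : nat) (hp : p \in [pchar k]).

Definition in_block (j : 'I_N.+1) : bool := (j <= r)%N || (n < j)%N.
Local Notation blk := in_block.

Hypothesis block_coord : forall j (b : 'I_n.+1), blk j -> (r < b)%N -> (bary j b)%:~R = 0 :> k.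
Hypothesis block_connected : forall z : 'I_N.+1 -> k,
  (forall j b, (bary j b)%:~R != 0 :> k -> z j = z (io b)) ->
  forall i j, blk i -> blk j -> z i = z j.
Hypothesis block_sign : exists j0 (b0 : 'I_n.+1), (b0 <= r)%N /\ bary j0 b0 = -1.

Definition block_constant (z : 'I_N.+1 -> k) :=
  forall i j, blk i -> blk j -> z i = z j.

Lemma block_basis (b : 'I_n.+1) : blk (io b) = (b <= r)%N.
Proof. by rewrite /in_block /= [(n < b)%N]ltnNge -[(b <= n)%N]/(b < n.+1)%N ltn_ord orbF. Qed.

Lemma nonblock_basis j : ~~ blk j -> exists2 b : 'I_n.+1, (r < b)%N & j = io b.
Proof.
rewrite negb_or -ltnNge -leqNgt => /andP[rj]; rewrite -ltnS => jn.
by exists (Ordinal jn) => //; apply/val_inj.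
Qed.

(** If [diag(z)] with [z = y / x] maps [V] to itself, then it multiplies the row
    of index [b], whose only nonzero basis coordinate is [b], by [z_b].
    Comparing coordinates [j] gives [z_j = z_b] whenever [b] occurs in [j]. *)
Lemma frame_sub_block_constant x y : (forall j, x 0 j != 0) ->
  row_space (frame y) `<=` row_space (frame x) ->
  block_constant (fun j => y 0 j / x 0 j).
Proof.
move=> x0 h; apply: block_connected => j b btjb.
have /h /= /submxP[phi e] : row_space (frame y) (row b (frame y)) by exact: row_sub.
have phiE b' : phi 0 b' = (b == b')%:R * (y 0 (io b) / x 0 (io b)).
  apply: (mulIf (x0 (io b'))); rewrite -(frame_mx_basis bary_basis) -e !mxE bary_basis.
  by have [<-|_] := eqVneq b b'; rewrite ?mul0r // !mul1r divfK.
have := congr1 (fun u : 'rV_ _ => u 0 j) e; rewrite /= frame_mxE (bigD1 b) //= big1.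
  rewrite addr0 phiE eqxx mul1r !mxE => e'; apply: (mulfI btjb).
  by rewrite mulrA e' mulfK // mulrC.
by move=> b' bb'; rewrite phiE eq_sym (negPf bb') !mul0r.
Qed.

(** Conversely, a diagonal matrix that is constant on the block multiplies each
    row by a scalar, since the rows have their support either in the block or at
    one coloop. *)
Lemma block_constant_frame x y : (forall j, x 0 j != 0) ->
  block_constant (fun j => y 0 j / x 0 j) ->
  frame y = diag_mx (\row_b (y 0 (io b) / x 0 (io b))) *m frame x.
Proof.
move=> x0 h; apply/matrixP => b j; rewrite mul_diag_mx !mxE.
rewrite mulrCA; have [->|btjb] := eqVneq ((bary j b)%:~R : k) 0; first by rewrite !mul0r.
congr (_ * _); suff -> : y 0 (io b) / x 0 (io b) = y 0 j / x 0 j by rewrite divfK.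
have [bj|/nonblock_basis[b' _ jE]] := boolP (blk j).
  apply: h => //; rewrite block_basis leqNgt.
  by apply: contraNN btjb => /(block_coord bj)->.
by move: btjb; rewrite jE bary_basis; case: (b' =P b) => [->|_] //; rewrite eqxx.
Qed.

Lemma block_constant_row_space x y : (forall j, x 0 j != 0) -> (forall j, y 0 j != 0) ->
  block_constant (fun j => y 0 j / x 0 j) ->
  row_space (frame y) = row_space (frame x).
Proof.
move=> x0 y0 h; have sub x1 y1 : (forall j, x1 0 j != 0) ->
    block_constant (fun j => y1 0 j / x1 0 j) ->
    row_space (frame y1) `<=` row_space (frame x1).
  move=> x10 h1 v /= yv; apply: submx_trans yv _.
  by rewrite (block_constant_frame x10 h1) submxMl.
apply/seteqP; split; apply: sub => // i j bi bj.
by rewrite -[LHS]invf_div -[RHS]invf_div (h i j).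
Qed.

Definition orbit_fiber x : set 'rV[k]_N.+1 :=
  [set y | O y /\ block_constant (fun j => y 0 j / x 0 j)].

Lemma orbit_fiber_sub x : O x -> orbit_fiber x `<=` gauss_fiber X x.
Proof.
move=> Ox y [Oy h]; split; first exact: torus_orbit_smooth bary_basis bary_sum _ Oy.
rewrite /gauss_map !(tangent_orbit bary_basis bary_sum) //.
exact: block_constant_row_space (orbit_neq0 Ox) (orbit_neq0 Oy) h.
Qed.

Section BoundaryPoints.
Variables (x y : 'rV[k]_N.+1).
Hypotheses (Ox : O x) (Xy : X y).
Hypothesis (Ty : embedded_tangent_space X y = row_space (frame x)).

Let x0 j : x 0 j != 0. Proof. exact: (orbit_neq0 Ox). Qed.

Let y_block : block_constant (fun j => y 0 j / x 0 j).
Proof.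
have sub : row_space (frame y) `<=` row_space (frame x).
  by rewrite -Ty; exact: frame_sub_tangent.
exact: frame_sub_block_constant x0 sub.
Qed.

Let i0 : 'I_N.+1 := io ord0.
Let bi0 : blk i0. Proof. by rewrite block_basis. Qed.

Let yE j : blk j -> y 0 j = y 0 i0 / x 0 i0 * x 0 j.
Proof. by move=> bj; rewrite (y_block bi0 bj) divfK. Qed.

(** If [y] vanishes on the block, then the one-parameter subgroup [s ^ bary j b0]
    fixes [y], so it preserves the tangent space [diag(x) V]. The image of
    [x] has coordinates [s] at [b0] and [1] at the other basis points, up to
    [x], and it can be in this space only if [s ^ -1 = 1 - (s - 1)], because
    some point has coefficient [-1] at [b0]; but this means [s = 1]. *)
Lemma boundary_block_neq0 j : blk j -> y 0 j != 0.
Proof.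
move=> bj; rewrite yE // !mulf_neq0 ?invr_eq0 //; apply/negP => /eqP y00.
have {}y00 i : blk i -> y 0 i = 0 by move=> bi; rewrite yE // y00 !mul0r.
have [j0 [b0 [b0r btj0]]] := block_sign.
have [s s0 s1] : exists2 s : k, s != 0 & s != 1.
  have [|s s0] := @poly_nonvanishing k ('X - 1%:P); first by rewrite polyXsubC_eq0.
  by rewrite hornerXsubC subr_eq0; exists s.
pose sb b := if b == b0 then s else 1.
have sb0 b : sb b != 0 by rewrite /sb; case: ifP; rewrite ?oner_neq0.
have ptE i : torus_pt bary sb 0 i = s ^ bary i b0.
  rewrite torus_ptE (bigD1 b0) //= /sb eqxx big1 ?mulr1 // => b /negPf->.
  by rewrite exp1rz.
pose J := diag_mx (torus_pt bary sb).
have JE (z : 'rV_N.+1) i : (z *m J) 0 i = z 0 i * s ^ bary i b0.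
  by rewrite mul_mx_diag mxE ptE.
have yJ : y *m J = y.
  apply/rowP => i; rewrite JE; have [/y00->|/nonblock_basis[b rb ->]] := boolP (blk i).
    by rewrite mul0r.
  by rewrite bary_basis; case: eqP => [e|_]; [by rewrite e ltnNge b0r in rb|rewrite mulr1].
have TJ v : embedded_tangent_space X y v -> embedded_tangent_space X y (v *m J).
  move=> Tv F hF vF; rewrite -/(dir_deriv _ _ _) -{1}yJ -dir_deriv_lin_pull.
  apply: Tv; first exact: lin_pull_homog.
  move=> z Xz; rewrite lin_pullE; apply: vF.
  have := closure_torus_action sb0 Xz; congr X; apply/rowP => i.
  by rewrite JE mxE ptE.
have xT : embedded_tangent_space X y x.
  rewrite Ty /=; apply/submxP; exists (const_mx 1); apply/rowP => i.
  rewrite frame_mxE; under eq_bigr do rewrite mxE mul1r.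
  by rewrite (bary_sumr k bary_sum) mul1r.
have := TJ _ xT; rewrite Ty => /submxP[phi e].
have phiE b : phi 0 b = if b == b0 then s else 1.
  apply: (mulIf (x0 (io b))); rewrite -(frame_mx_basis bary_basis) -e JE bary_basis mulrC.
  by congr (_ * _); case: eqP.
have := congr1 (fun u : 'rV_ _ => u 0 j0) e; rewrite /= JE frame_mxE mulrC.
move/(mulIf (x0 j0)); rewrite btj0.
have -> : \sum_b phi 0 b * (bary j0 b)%:~R = 1 + (s - 1) * (bary j0 b0)%:~R.
  rewrite -[X in _ = X + _](bary_sumr k bary_sum j0) (bigD1 b0) //= [X in _ = X + _](bigD1 b0) //=.
  rewrite phiE eqxx (eq_bigr (fun b => (bary j0 b)%:~R)) => [|b /negPf bb0]; first by ring.
  by rewrite phiE bb0 mul1r.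
rewrite btj0 mulrN1 opprB addrA => /(congr1 (fun t => t * s)).
rewrite mulVf // => /eqP; rewrite eq_sym -subr_eq0.
have -> : (1 + 1 - s) * s - 1 = - (s - 1) ^+ 2 by ring.
by rewrite oppr_eq0 expf_eq0 /= subr_eq0 (negPf s1).
Qed.

(** Suppose that the coordinate of [y] at the coloop [b] vanishes although points
    of the block involve [b]. Divide the coefficients at [b] of the points of
    the block by their content [q]. The result [la] is a cocharacter of the
    torus of [y], because its [q]-th multiple is one and [q]-th roots exist in
    [k]; so [y * la] is tangent to [X] at [y]. It vanishes at all basis points,
    as the only one of them that involves [b] is [b] itself, where [y] is zero.
    But a vector of [diag(x) V] that vanishes at the basis points is zero, and
    [la] is nonzero modulo [p]. *)
Lemma boundary_coord_eq0 (b : 'I_n.+1) j :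
  y 0 (io b) = 0 -> blk j -> bary j b = 0.
Proof.
move=> yb bj; apply/eqP; apply: contraT => btjb.
have rb : (r < b)%N.
  by rewrite ltnNge -block_basis; apply/negP => /boundary_block_neq0/eqP.
pose a i := if blk i then bary i b else 0.
have [|q [la [q0 aE [i ila]]]] := divide_out (a := a) (pcharf_prime hp).
  by exists j; rewrite /a bj.
have laN i' : ~~ blk i' -> la i' = 0.
  move=> bi'; have := aE i'; rewrite /a (negPf bi') => /esym/eqP.
  by rewrite mulf_eq0 eqz_nat eqn0Ngt q0 => /eqP.
have bi : blk i by apply: contraNT ila => /laN->; rewrite dvdz0.
pose v : 'rV[k]_N.+1 := \row_j (y 0 j * (la j)%:~R).
have Tv : embedded_tangent_space X y v.
  move=> F [e hF] vF; under eq_bigr do rewrite mxE.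
  apply: (int_curve_tangent hF) => s s0.
  have [t tq] := closed_field_root s q0.
  have t0 : t != 0 by apply: contraNneq s0 => t0; rewrite -tq t0 expr0n eqn0Ngt q0.
  pose sb b' := if b' == b then t else 1.
  have sb0 b' : sb b' != 0 by rewrite /sb; case: ifP; rewrite ?oner_neq0.
  rewrite -[RHS](vF _ (closure_torus_action sb0 Xy)); apply: meval_eq => i'.
  rewrite mxE torus_ptE (bigD1 b) //= /sb eqxx big1 => [|b' /negPf->]; last first.
    by rewrite exp1rz.
  rewrite mulr1; have [bi'|bi'] := boolP (blk i').
    by rewrite -tq exprnP exprz_exp -aE /a bi'.
  rewrite laN // expr0z mulr1; have [b' _ ->] := nonblock_basis bi'.
  rewrite bary_basis; case: eqP => [->|_]; last by rewrite mulr1.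
  by rewrite yb !mul0r.
move: Tv; rewrite Ty => /submxP[phi e].
have phi0 : phi = 0.
  apply/rowP => b'; apply: (mulIf (x0 (io b'))).
  rewrite -(frame_mx_basis bary_basis) -e !mxE mul0r.
  suff -> : la (io b') = 0 by rewrite mulr0.
  have [br|br] := boolP (blk (io b')); last exact: laN.
  have := aE (io b'); rewrite /a br bary_basis.
  case: eqP => [bb'|_ /esym/eqP]; first by move: br; rewrite block_basis bb' leqNgt rb.
  by rewrite mulf_eq0 eqz_nat eqn0Ngt q0 => /eqP.
have := congr1 (fun u : 'rV_ _ => u 0 i) e; rewrite phi0 mul0mx !mxE => /eqP.
rewrite mulf_eq0 (negPf (boundary_block_neq0 bi)) /=.
by move: ila; rewrite -(dvdz_pcharf hp) => /negPf->.
Qed.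

(** Replacing the zero coordinates of [y] by [s] gives for [s != 0] a point of
    the orbit, since by [boundary_coord_eq0] no other coordinate depends on
    them, and this point has the same ratio to [x] on the block. *)
Lemma boundary_in_closure : zariski_closure (orbit_fiber x) y.
Proof.
have fiber0 : nonzero_set (orbit_fiber x).
  by move=> z [Oz _]; apply: orbit_nonzero Oz.
apply/(closureP _ fiber0); split; first exact: (closure_nonzero (@orbit_nonzero k n N bary)) Xy.
move=> F hF vF; pose c j : {poly k} := if y 0 j == 0 then 'X else (y 0 j)%:P.
suff : along F c = 0.
  move/(congr1 (fun P => P.[0])); rewrite horner0 along_horner => h; rewrite -[RHS]h.
  apply: meval_eq => j; rewrite /c; case: eqP => [->|_]; by rewrite ?hornerX ?hornerC.
apply: poly_vanishing => s s0; rewrite along_horner.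
pose z : 'rV[k]_N.+1 := \row_j (if y 0 j == 0 then s else y 0 j).
have -> : F.@[fun j => (c j).[s]] = F.@[z 0].
  by apply: meval_eq => j; rewrite mxE /c; case: eqP => _; rewrite ?hornerX ?hornerC.
have zy j : y 0 j != 0 -> z 0 j = y 0 j by rewrite mxE => /negPf->.
have z0 j : z 0 j != 0 by rewrite mxE; case: ifP => // /negbT.
apply: vF; split.
  apply: (orbit_of_basis (hnN := hnN)) => // j.
  have [bj|/nonblock_basis[b _ ->]] := boolP (blk j); last first.
    rewrite (bigD1 b) //= bary_basis eqxx big1 ?mulr1 // => b' bb'.
    by rewrite bary_basis eq_sym (negPf bb').
  rewrite zy ?boundary_block_neq0 // (closure_basisE bary_basis bary_sum Xy) => [|b btjb].
    apply: eq_bigr => b _; have [yb|yb] := eqVneq (y 0 (io b)) 0; last by rewrite zy.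
    by rewrite (boundary_coord_eq0 yb bj).
  by apply: contraNneq btjb => yb; rewrite (boundary_coord_eq0 yb bj).
by move=> i j bi bj; rewrite !zy ?boundary_block_neq0 //; apply: y_block.
Qed.

End BoundaryPoints.

Lemma gauss_fiber_sub_closure x : O x ->
  gauss_fiber X x `<=` zariski_closure (orbit_fiber x).
Proof.
move=> Ox y [[Xy _] e]; apply: boundary_in_closure => //.
by rewrite -(tangent_orbit bary_basis bary_sum Ox).
Qed.

End GaussFibers.

(** * The rank of the Gauss map *)

Section GaussRank.
Variables (k : closedFieldType) (n N : nat) (hnN : (n.+1 <= N.+1)%N).
Variable bary : 'I_N.+1 -> 'I_n.+1 -> int.
Let io (b : 'I_n.+1) : 'I_N.+1 := widen_ord hnN b.
Hypothesis bary_basis : forall b b', bary (io b) b' = (b == b')%:R.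
Hypothesis bary_sum : forall j, \sum_b bary j b = 1.
Implicit Types (F : {mpoly k[N.+1]}) (x y : 'rV[k]_N.+1) (tau : 'I_n.+1 -> k).
Local Notation O := (torus_orbit (k := k) bary).
Local Notation X := (torus_closure (k := k) bary).
Local Notation frame := (frame_mx (k := k) bary).
Variables (r : nat) (hrn : (r <= n)%N).
Local Notation blk := (in_block n r).
Hypothesis block_coord : forall j (b : 'I_n.+1), blk j -> (r < b)%N -> (bary j b)%:~R = 0 :> k.
Hypothesis block_connected : forall z : 'I_N.+1 -> k,
  (forall j b, (bary j b)%:~R != 0 :> k -> z j = z (io b)) ->
  forall i j, blk i -> blk j -> z i = z j.

Definition frame_poly : 'M[{mpoly k[N.+1]}]_(n.+1, N.+1) :=
  \matrix_(b, j) ((bary j b)%:~R *: 'X_j).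

Lemma frame_poly_eval x : map_mx (meval (x 0)) frame_poly = frame x.
Proof. by apply/matrixP => b j; rewrite !mxE mevalZ mevalXU. Qed.

Lemma frame_poly_derivative x v : frame_derivative frame_poly x v = frame v.
Proof.
apply/matrixP => b j; rewrite !mxE (bigD1 j) //= big1 => [|l lj].
  by rewrite ?mxE mderivZ mevalZ mderivU eqxx meval1 mulr1 addr0.
by rewrite ?mxE mderivZ mevalZ mderivU eq_sym (negPf lj) meval0 mulr0 mul0r.
Qed.

Lemma frame_poly_gauss_frame x : O x -> gauss_frame X x frame_poly.
Proof.
move=> Ox; have [Z [cZ ZO]] := orbit_complement_closed k bary_basis bary_sum.
exists Z; split=> //; first by apply/(ZO _ (sub_orbit_closure Ox)).
move=> y Xy nZ /=; rewrite frame_poly_eval.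
have Oy : O y by apply/(ZO _ Xy).
split; last exact: (tangent_orbit bary_basis bary_sum Oy).
by apply: (frame_mx_free bary_basis) => b; apply: (orbit_neq0 Oy).
Qed.

Let differential x (v : 'rV[k]_N.+1) := mxvec (gauss_differential frame_poly x v).

Let differentialE x (u : 'rV[k]_N.+1) :
  u *m lin1_mx (differential x) = mxvec (frame u *m cokermx (frame x)).
Proof.
have E v : differential x v = mxvec (frame v *m cokermx (frame x)).
  by rewrite /differential /gauss_differential frame_poly_derivative frame_poly_eval.
have lin : linear (differential x).
  move=> a v w; rewrite !E; have -> : frame (a *: v + w) = a *: frame v + frame w.
    by apply/matrixP => b j; rewrite !mxE mulrDr mulrCA.
  by rewrite mulmxDl -scalemxAl linearP.
pose D : {linear 'rV[k]_N.+1 -> 'rV[k]_(n.+1 * N.+1)} :=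
  HB.pack (differential x) (GRing.isLinear.Build _ _ _ _ (differential x) lin).
by rewrite -E; exact: (mul_rV_lin1 D).
Qed.

(** The derivative of [frame_poly] along [v = diag(z) x] is [frame v], and it
    vanishes modulo the row space of [frame x] iff [diag(z)] preserves [V], iff
    [z] is constant on the block. For [z] in [V] it suffices to test this at the
    basis points. *)
Lemma differential_kernel x (phi : 'rV[k]_n.+1) : O x ->
  (phi *m (frame x *m lin1_mx (differential x)) == 0) =
  [forall b : 'I_n.+1, (b <= r)%N ==> (phi 0 b == phi 0 ord0)].
Proof.
move=> Ox; have x0 := orbit_neq0 Ox.
rewrite mulmxA differentialE mxvec_eq0; set y := phi *m frame x.
have yE j : y 0 j / x 0 j = \sum_b phi 0 b * (bary j b)%:~R by rewrite frame_mxE mulfK.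
have yb b : y 0 (io b) / x 0 (io b) = phi 0 b by rewrite frame_mx_basis // mulfK.
rewrite -submxE; apply/idP/forallP => [sub b|h].
  apply/implyP => br; apply/eqP; rewrite -!yb.
  apply: (frame_sub_block_constant bary_basis block_connected x0).
  - by move=> v /= yv; apply: submx_trans sub.
  - by rewrite block_basis.
  - by rewrite block_basis.
suff yc : block_constant n r (fun j => y 0 j / x 0 j).
  by rewrite (block_constant_frame bary_basis block_coord x0 yc) submxMl.
suff E j : blk j -> y 0 j / x 0 j = phi 0 ord0 by move=> i j bi bj; rewrite !E.
move=> bj; rewrite yE; transitivity (\sum_b phi 0 ord0 * (bary j b)%:~R).
  apply: eq_bigr => b _; have [br|br] := leqP b r; last by rewrite block_coord ?mulr0.
  by have /implyP/(_ br)/eqP-> := h b.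
by rewrite -mulr_sumr (bary_sumr k bary_sum) mulr1.
Qed.

Lemma torus_gauss_rank x : O x -> gauss_rank_at X x r.
Proof.
move=> Ox; exists n, frame_poly; split; first exact: frame_poly_gauss_frame.
rewrite frame_poly_eval -/(differential x); set M := _ *m _.
have hr (i : 'I_r) : (i.+1 < n.+1)%N by rewrite ltnS (leq_trans (ltn_ord i)).
(* [P] has the kernel found in [differential_kernel], and its rank is visible *)
pose up (i : 'I_r) : 'I_n.+1 := Ordinal (hr i).
pose P : 'M[k]_(n.+1, r) := \matrix_(b, i) ((b == up i)%:R - (b == ord0)%:R).
have phiP (phi : 'rV_n.+1) i : (phi *m P) 0 i = phi 0 (up i) - phi 0 ord0.
  rewrite mxE; under eq_bigr do rewrite mxE mulrBr.
  rewrite sumrB (bigD1 (up i)) //= eqxx mulr1 big1 ?addr0 => [|b /negPf->].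
    by rewrite (bigD1 ord0) //= mulr1 big1 ?addr0 // => b /negPf->; rewrite mulr0.
  by rewrite mulr0.
have ker (phi : 'rV_n.+1) : (phi *m M == 0) = (phi *m P == 0).
  rewrite differential_kernel //; apply/forallP/eqP => [h|h b].
    apply/rowP => i; rewrite phiP mxE; apply/eqP; rewrite subr_eq0.
    by have := h (up i); rewrite /= ltn_ord.
  apply/implyP => br; have [->//|b0] := eqVneq b ord0.
  have b1 : (b.-1 < r)%N by rewrite prednK // lt0n.
  have := congr1 (fun u : 'rV_r => u 0 (Ordinal b1)) h; rewrite phiP mxE => /eqP.
  rewrite subr_eq0; congr (phi _ _ == _); apply/val_inj => /=.
  by rewrite prednK // lt0n.
have rP : \rank P = r.
  apply/eqP; rewrite eqn_leq rank_leq_col /=.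
  pose Q : 'M[k]_(r, n.+1) := \matrix_(i, b) (b == up i)%:R.
  have QP : Q *m P = 1%:M.
    apply/matrixP => i j; have := phiP (row i Q) j; rewrite -row_mul !mxE => ->.
    have -> : (ord0 == up i) = false by [].
    by rewrite subr0 -val_eqE /= eqSS eq_sym.
  by rewrite -{1}(mxrank1 k r) -QP mxrankM_maxr.
have : \rank (kermx M) = \rank (kermx P).
  apply/eqP; rewrite eqn_leq; apply/andP; split; apply/mxrankS/row_subP => i.
    by apply/sub_kermxP/eqP; rewrite -ker; apply/eqP/sub_kermxP/row_sub.
  by apply/sub_kermxP/eqP; rewrite ker; apply/eqP/sub_kermxP/row_sub.
rewrite !mxrank_ker rP => e; have := rank_leq_row M.
by rewrite leq_eqVlt; move: e hrn; set m := \rank M; clear; lia.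
Qed.

End GaussRank.

(** * Roots of unity and characters of free abelian groups *)

Lemma roots_of_unity (k : closedFieldType) (p c : nat) : p \in [pchar k] ->
  (0 < c)%N -> coprime c p ->
  exists z : 'I_c -> k, injective z /\ forall a, a ^+ c = 1 <-> exists i, z i = a.
Proof.
move=> hp c0 cp; pose P : {poly k} := 'X^c - 1%:P.
have c0k : c%:R != 0 :> k.
  rewrite -(dvdn_pcharf hp); apply: contraL cp => pc; rewrite /coprime.
  by rewrite (gcdn_idPr pc) neq_ltn (prime_gt1 (pcharf_prime hp)) orbT.
have sep : separable_poly P.
  rewrite unlock; apply/coprimepP => d dP dP'.
  suff : d %| 1 by rewrite dvdp1 size_poly_eq1.
  have -> : 1 = (c%:R^-1 *: 'X) * P^`() - P.
    rewrite derivB derivXn derivC subr0 -scaler_nat -scalerAr -scalerAl scalerA.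
    by rewrite mulfV // scale1r -exprS prednK // opprB addrC subrK.
  by rewrite dvdp_sub ?dvdp_mull.
have [s sE] := closed_field_poly_normal P.
have lP : lead_coef P = 1 by rewrite lead_coefXnsubC.
rewrite lP scale1r in sE.
have us : uniq s by rewrite -separable_prod_XsubC -sE.
have ss : size s = c.
  by have := size_XnsubC (1 : k) c0; rewrite -/P sE size_prod_XsubC => -[].
have rs a : (a \in s) = (a ^+ c == 1).
  by rewrite -root_prod_XsubC -sE /root /P !hornerE subr_eq0.
exists (fun i => s`_i); split=> [i j /eqP|a].
  by rewrite nth_uniq ?ss // => /eqP/val_inj.
rewrite (rwP eqP) -rs; split=> [/(nthP 0)[i]|[i <-]]; last by rewrite mem_nth ?ss.
by rewrite ss => ic <-; exists (Ordinal ic).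
Qed.

Section TorusCharacters.
Variables (k : closedFieldType) (M : zmodType).
Implicit Type t : M -> k.

Lemma torus_neq0 t u : torus t -> t u != 0.
Proof.
move=> [t0 tD]; have := tD u (- u); rewrite subrr t0 => /eqP.
by apply: contraTneq => ->; rewrite mul0r oner_neq0.
Qed.

Lemma torus_opp t u : torus t -> t (- u) = (t u)^-1.
Proof.
move=> ht; apply: (mulfI (torus_neq0 u ht)); rewrite mulfV ?torus_neq0 //.
by have [t0 <-] := ht; rewrite subrr.
Qed.

Lemma torus_mulz t u (z : int) : torus t -> t (u *~ z) = t u ^ z.
Proof.
move=> ht; have [t0 tD] := ht.
have tn (m : nat) : t (u *+ m) = t u ^+ m.
  by elim: m => [|m IH]; rewrite ?mulr0n // mulrS exprS tD IH.
case: z => m; first exact: tn.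
by rewrite NegzE mulrNz (torus_opp _ ht) [t (u *~ _)]tn exprnN.
Qed.

Lemma torus_sum (I : Type) (s : seq I) (f : I -> M) t : torus t ->
  t (\sum_(i <- s) f i) = \prod_(i <- s) t (f i).
Proof.
by move=> [t0 tD]; exact: (big_morph t tD t0).
Qed.

Section Basis.
Variables (m : nat) (e : 'I_m -> M).
Hypothesis e_bij : bijective (fun a : 'rV[int]_m => \sum_i e i *~ a 0 i).

Lemma torus_of_basis (tau : 'I_m -> k) : (forall i, tau i != 0) ->
  exists t, torus t /\
    forall a : 'rV[int]_m, t (\sum_i e i *~ a 0 i) = \prod_i tau i ^ a 0 i.
Proof.
move=> tau0; have [crd crdK Kcrd] := e_bij.
exists (fun u => \prod_i tau i ^ crd u 0 i); split; last by move=> a; rewrite crdK.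
split.
  rewrite -[X in crd X](_ : \sum_i e i *~ (0 : 'rV[int]_m) 0 i = 0).
    by rewrite crdK big1 // => i _; rewrite mxE expr0z.
  by apply: big1 => i _; rewrite mxE mulr0z.
move=> u v; have -> : crd (u + v) = crd u + crd v.
  rewrite -[RHS]crdK; congr crd; rewrite -{1}[u]Kcrd -{1}[v]Kcrd -big_split.
  by apply: eq_bigr => i _; rewrite mxE mulrzDr.
by rewrite -big_split; apply: eq_bigr => i _; rewrite mxE expfzDr.
Qed.

End Basis.

Variables (N : nat) (u : 'I_N.+1 -> M).

Definition character_set : set 'rV[k]_N.+1 := [set x | exists t (l : k),
    [/\ torus t, l != 0 & x = l *: \row_i t (u i)]].

Lemma character_set_neq0 x : character_set x -> forall j, x 0 j != 0.
Proof.
by move=> [t [l [ht l0 ->]]] j; rewrite !mxE mulf_neq0 // torus_neq0.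
Qed.

Lemma character_set_nonzero : nonzero_set character_set.
Proof.
move=> x /character_set_neq0/(_ ord0) x0; apply: contraNneq x0 => ->.
by rewrite mxE.
Qed.

(** In a basis of [M], the coordinates are monomials in the scaling factor and
    the values of the character at the basis. *)
Lemma character_set_irreducible m : free_of_rank M m -> irreducible_set character_set.
Proof.
move=> [e e_bij]; have [crd crdK Kcrd] := e_bij.
pose D (j : 'I_N.+1) (b : 'I_m.+1) := if unlift ord0 b is Some i then crd (u j) 0 i else 1.
suff -> : character_set = mono_set (const_mx 1) D.
  apply: mono_set_irreducible; apply/eqP => /rowP/(_ ord0)/eqP.
  by rewrite !mxE oner_eq0.
have DE tau j : \prod_b tau b ^ D j b =
    tau ord0 * \prod_i tau (lift ord0 i) ^ crd (u j) 0 i :> k.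
  rewrite big_ord_recl /D unlift_none expr1z; congr (_ * _).
  by apply: eq_bigr => i _; rewrite liftK.
apply/seteqP; split=> [x [t [l [ht l0 ->]]]|x [tau [tau0 ->]]].
  exists (fun b => if unlift ord0 b is Some i then t (e i) else l); split.
    by move=> b; case: unliftP => [i|] _ //; apply: torus_neq0.
  apply/rowP => j; rewrite !mxE mul1r DE unlift_none; congr (_ * _).
  rewrite -{1}[u j]Kcrd torus_sum //; apply: eq_bigr => i _.
  by rewrite liftK torus_mulz.
have [t [ht tE]] := torus_of_basis e_bij (fun i => tau0 (lift ord0 i)).
exists t, (tau ord0); split=> //; apply/rowP => j.
by rewrite !mxE mul1r DE -tE Kcrd.
Qed.

End TorusCharacters.

(** * The components of a Gauss fiber *)

(** [block_constantP] describes the characters that are constant on the block: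
    up to scaling they are products of a character of [M'], seen through
    [sigma], and of a power [z ^ theta] of a [c]-th root of unity. The monomial
    with exponents [kappa] recovers [z] from such a product. *)
Section FiberComponents.
Variables (k : closedFieldType) (n N : nat) (hnN : (n.+1 <= N.+1)%N).
Variable bary : 'I_N.+1 -> 'I_n.+1 -> int.
Let io (b : 'I_n.+1) : 'I_N.+1 := widen_ord hnN b.
Hypothesis bary_basis : forall b b', bary (io b) b' = (b == b')%:R.
Hypothesis bary_sum : forall j, \sum_b bary j b = 1.
Implicit Types (x y : 'rV[k]_N.+1).
Local Notation O := (torus_orbit (k := k) bary).
Local Notation X := (torus_closure (k := k) bary).
Variables (p r : nat) (hp : p \in [pchar k]).
Local Notation blk := (in_block n r).
Hypothesis block_coord : forall j (b : 'I_n.+1), blk j -> (r < b)%N -> (bary j b)%:~R = 0 :> k.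
Hypothesis block_connected : forall z : 'I_N.+1 -> k,
  (forall j b, (bary j b)%:~R != 0 :> k -> z j = z (io b)) ->
  forall i j, blk i -> blk j -> z i = z j.
Hypothesis block_sign : exists j0 (b0 : 'I_n.+1), (b0 <= r)%N /\ bary j0 b0 = -1.

Variables (M' : zmodType) (m' N' : nat) (A' : 'I_N'.+1 -> M').
Hypothesis free_M' : free_of_rank M' m'.
Variables (c : nat) (hc : (0 < c)%N).
Variables (sigma : 'I_N.+1 -> 'I_N'.+1) (theta kappa : 'I_N.+1 -> int).
Hypothesis sigma_surj : forall i, exists j, sigma j = i.
Hypothesis block_constantP : forall w : 'rV[k]_N.+1,
  O w /\ block_constant n r (w 0) <->
  exists z t l, [/\ z ^+ c = 1, torus t, l != 0 &
    forall j, w 0 j = z ^ theta j * (l * t (A' (sigma j)))].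
Hypotheses (kappa_sum : \sum_j kappa j = 0) (kappa_theta : \sum_j kappa j * theta j = 1)
  (kappa_A' : \sum_j A' (sigma j) *~ kappa j = 0).

Section Fiber.
Variables (x : 'rV[k]_N.+1) (Ox : O x) (z : 'I_c -> k).
Hypotheses (z_inj : injective z) (zP : forall a, a ^+ c = 1 <-> exists i, z i = a).

Let x0 j : x 0 j != 0. Proof. exact: (orbit_neq0 Ox). Qed.

Let zc i : z i ^+ c = 1. Proof. by apply/zP; exists i. Qed.

Let z0 i : z i != 0.
Proof.
by apply: contra_eq_neq (zc i) => ->; rewrite expr0n eqn0Ngt hc eq_sym oner_neq0.
Qed.

(** The coset of index [i] is the image under this matrix of the orbit of
    [X_A']. *)
Definition component_mx i : 'M[k]_(N'.+1, N.+1) :=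
  \matrix_(l, j) ((sigma j == l)%:R * (x 0 j * z i ^ theta j)).

Local Notation S := (@character_set k M' _ A').

Definition fiber_component i := (fun s => s *m component_mx i) @` S.

Lemma component_mxE i (s : 'rV_N'.+1) j :
  (s *m component_mx i) 0 j = s 0 (sigma j) * (x 0 j * z i ^ theta j).
Proof.
rewrite mxE (bigD1 (sigma j)) //= mxE eqxx mul1r big1 ?addr0 // => l lj.
by rewrite mxE eq_sym (negPf lj) mul0r mulr0.
Qed.

Lemma component_mx_free i : row_free (component_mx i).
Proof.
have [sec secK] := choice sigma_surj.
apply/row_freeP; exists (\matrix_(j, l) ((j == sec l)%:R / (x 0 j * z i ^ theta j))).
apply/matrixP => a b; rewrite !mxE (bigD1 (sec b)) //= !mxE eqxx mul1r big1.
  by rewrite addr0 secK -mulrA mulfV ?mulr1 ?mulf_neq0 ?expfz_neq0 // eq_sym.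
by move=> j jb; rewrite !mxE (negPf jb) mul0r mulr0.
Qed.

Lemma fiber_component_closure i :
  zariski_closure (fiber_component i) =
  (fun s => s *m component_mx i) @` toric_variety k A'.
Proof.
by apply: closure_linear (component_mx_free i) _; apply: character_set_nonzero.
Qed.

Lemma orbit_fiberE : orbit_fiber bary r x = [set y | exists i, fiber_component i y].
Proof.
have [tx [tx0 xE]] := Ox; rewrite -/(torus_pt bary tx) in xE.
apply/seteqP; split=> [y [[ty [ty0 yE]] h]|_ [i [_ [t [l [ht l0 ->]]] <-]]].
  rewrite -/(torus_pt bary ty) in yE; pose tau b := ty b / tx b.
  have tau0 b : tau b != 0 by rewrite mulf_neq0 ?invr_eq0.
  have tauE j : y 0 j = torus_pt bary tau 0 j * x 0 j.
    rewrite xE -torus_ptM yE; congr (torus_pt bary _ 0 j).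
    by apply/funext => b; rewrite divfK.
  have /block_constantP[a [t [l [ac ht l0 e]]]] :
      O (torus_pt bary tau) /\ block_constant n r (torus_pt bary tau 0).
    split; first by exists tau.
    by move=> u v bu bv; have := h u v bu bv; rewrite !tauE !mulfK.
  have /zP[i zi] := ac; exists i; exists (l *: \row_j t (A' j)); first by exists t, l.
  by apply/rowP => j; rewrite component_mxE tauE e zi !mxE; ring.
pose w : 'rV[k]_N.+1 := \row_j (z i ^ theta j * (l * t (A' (sigma j)))).
have [|[tau [tau0 wE]] wc] := (block_constantP w).2.
  by exists (z i), t, l; split=> // j; rewrite mxE.
rewrite -/(torus_pt bary tau) in wE.
set y := _ *m _; have yE j : y 0 j = w 0 j * x 0 j.
  by rewrite component_mxE !mxE; ring.
split; last by move=> u v bu bv; rewrite !yE !mulfK //; exact: wc.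
exists (fun b => tau b * tx b); split=> [b|]; first by rewrite mulf_neq0.
by apply/rowP => j; rewrite yE wE xE -torus_ptM.
Qed.

Let kappa_value i (s : 'rV[k]_N'.+1) : S s ->
  \prod_j (s *m component_mx i) 0 j ^ kappa j = (\prod_j x 0 j ^ kappa j) * z i.
Proof.
move=> [t [l [ht l0 ->]]].
transitivity (\prod_j (x 0 j ^ kappa j * (z i ^ (theta j * kappa j) *
    (l ^ kappa j * t (A' (sigma j) *~ kappa j))))).
  apply: eq_bigr => j _; rewrite component_mxE !mxE torus_mulz //.
  by rewrite -exprz_exp -!expfzMl; congr (_ ^ _); ring.
rewrite !big_split /= -(torus_sum _ _ ht) kappa_A'; have [-> _] := ht.
have -> : \prod_j l ^ kappa j = 1.
  by rewrite -(big_morph _ (fun u v => expfzDr u v l0) (expr0z l)) kappa_sum expr0z.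
rewrite -(big_morph _ (fun u v => expfzDr u v (z0 i)) (expr0z (z i))).
by rewrite (eq_bigr _ (fun j _ => mulrC (theta j) (kappa j))) kappa_theta expr1z !mulr1.
Qed.

(** On the component of index [i] the monomial with exponents [kappa] is [z i]
    times its value at [x]; this is a homogeneous equation, so it holds on the
    closure. *)
Lemma fiber_component_inj i1 i2 :
  fiber_component i1 `<=` zariski_closure (fiber_component i2) -> i1 = i2.
Proof.
move=> sub; pose K := \prod_j x 0 j ^ kappa j.
have K0 : K != 0 by rewrite prodf_seq_neq0; apply/allP => j _; rewrite expfz_neq0.
pose Fl : {mpoly k[N.+1]} := \prod_j 'X_j ^+ pos_part (kappa j).
pose Fr : {mpoly k[N.+1]} := \prod_j 'X_j ^+ neg_part (kappa j).
pose F := Fl - (K * z i2) *: Fr.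
have hF : homogeneous F.
  exists (\sum_j pos_part (kappa j))%N; rewrite rpredB ?prod_vars_homog ?rpredZ //.
  have -> : (\sum_j pos_part (kappa j) = \sum_j neg_part (kappa j))%N; last exact: prod_vars_homog.
  have := kappa_sum; rewrite (eq_bigr _ (fun j _ => pos_neg_part (kappa j))).
  by rewrite sumrB -!(big_morph Posz PoszD (erefl _)) => /eqP; rewrite subr_eq0 => /eqP[].
have FE (y : 'rV[k]_N.+1) : (forall j, y 0 j != 0) ->
    (F.@[y 0] == 0) = (\prod_j y 0 j ^ kappa j == K * z i2).
  move=> y0; rewrite mevalB mevalZ subr_eq0.
  rewrite !prod_vars_eval; under eq_bigr do rewrite -exprz_parts //.
  rewrite big_split /=; apply: (inj_eq (mulIf _)).
  by rewrite prodf_seq_neq0; apply/allP => j _; rewrite expf_neq0.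
have nz i s : S s -> forall j, (s *m component_mx i) 0 j != 0.
  move=> /character_set_neq0 s0 j.
  by rewrite component_mxE !mulf_neq0 // expfz_neq0.
have vF : vanishes_on F (fiber_component i2).
  by move=> _ [s Ss <-]; apply/eqP; rewrite FE; [rewrite kappa_value|exact: nz].
have C0 : nonzero_set (fiber_component i2).
  move=> _ [s Ss <-]; apply: contraTneq (nz i2 s Ss ord0) => ->.
  by rewrite mxE eqxx.
have [s Ss] := (character_set_irreducible k A' free_M').1.
have := closure_vanishing hF C0 vF (sub _ (ex_intro2 _ _ s Ss erefl)) => /eqP.
rewrite FE; last exact: nz.
by rewrite kappa_value // => /eqP/(mulfI K0)/z_inj.
Qed.

Let comps := enum 'I_c.

Let C0 i : nonzero_set (fiber_component i).
Proof.
move=> _ [s Ss <-]; apply: contraNneq (character_set_nonzero Ss) => h.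
by rewrite -[s](mulmxKp (component_mx_free i)) h mul0mx.
Qed.

Let Cirr i : irreducible_set (fiber_component i).
Proof.
apply: irreducible_linear (component_mx_free i) (@character_set_nonzero k M' _ A') _.
exact: (character_set_irreducible k A' free_M').
Qed.

Let CE i : i \in comps -> fiber_component i `<=` gauss_fiber X x.
Proof.
move=> _ y Cy; apply: (orbit_fiber_sub bary_basis bary_sum block_coord Ox).
by rewrite orbit_fiberE; exists i.
Qed.

Let EC : gauss_fiber X x `<=`
  [set y | exists2 i, i \in comps & zariski_closure (fiber_component i) y].
Proof.
have sub := gauss_fiber_sub_closure bary_basis bary_sum hp block_connected
  block_sign Ox.
apply: subset_trans sub _.
apply: closure_min; first by apply: closed_bigU => i; apply: closure_closed.
rewrite orbit_fiberE => y [i Ci]; exists i; first by rewrite mem_enum.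
exact: sub_closure.
Qed.

Let Cinj i j : i \in comps -> j \in comps ->
  fiber_component i `<=` zariski_closure (fiber_component j) -> i = j.
Proof. by move=> _ _; exact: fiber_component_inj. Qed.

Let componentsE := irreducible_componentsE C0 Cirr CE EC Cinj.

Lemma fiber_components_projective C : irreducible_components (gauss_fiber X x) C ->
  projectively_equivalent (X `&` zariski_closure C) (toric_variety k A').
Proof.
rewrite componentsE => -[i /= ci <-].
rewrite (component_closure C0 CE ci) setIidr; last first.
  apply: closure_min; first exact: closure_closed (@orbit_nonzero k n N bary).
  by move=> y /(CE ci)[[]].
exists N, 1%:M, (component_mx i); split; first by rewrite row_free_unit unitmx1.
  exact: component_mx_free.
rewrite -fiber_component_closure; apply/seteqP.
by split=> [_ [y Cy <-]|y Cy]; [rewrite mulmx1|exists y => //; rewrite mulmx1].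
Qed.

Lemma fiber_components_card :
  (irreducible_components (gauss_fiber X x) #= `I_c)%card.
Proof.
rewrite componentsE; apply: card_eq_trans (inj_card_eq (component_inj CE Cinj)) _.
rewrite (_ : [set` comps] = [set: 'I_c]); first by rewrite card_eq_sym; exact: card_II.
by apply/seteqP; split=> // i _ /=; rewrite mem_enum.
Qed.

End Fiber.
End FiberComponents.

(** * Integer linear algebra for the configuration *)

(** A split surjection [S] onto [Z^m] has a free kernel with basis the rows of
    [G], and [Z^(m+q)] is the sum of this kernel and of the image of a section
    [E]. In the Smith form [S = L D R] the diagonal is invertible, so that the
    first columns of [L] span the image of [S] and the last rows of [L^-1] its
    kernel. *)
Lemma split_surjection m q (S : 'M[int]_(m + q, m)) (E0 : 'M[int]_(m, m + q)) :
  E0 *m S = 1%:M ->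
  exists (E : 'M[int]_(m, m + q)) (Th : 'M[int]_(m + q, q)) (G : 'M[int]_(q, m + q)),
    [/\ G *m S = 0, G *m Th = 1%:M & S *m E + Th *m G = 1%:M].
Proof.
move=> E0S; have [L uL [R uR [ds _ SE]]] := int_Smith_normal_form S.
pose D1 : 'M[int]_m := \matrix_(i, j) (ds`_i *+ (i == j :> nat)).
have DE : (\matrix_(i < m + q, j < m) (ds`_i *+ (i == j :> nat))) = col_mx D1 0.
  apply/matrixP => i j; rewrite mxE; case: (split_ordP i) => i' ->.
    by rewrite col_mxEu mxE.
  rewrite col_mxEd [RHS]mxE; suff -> : (rshift m i' == j :> nat) = false by [].
  by apply: gtn_eqF => /=; exact: leq_trans (ltn_ord j) (leq_addr _ _).
pose T := D1 *m R.
have ST : S = lsubmx L *m T.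
  by rewrite SE DE -[L in LHS]hsubmxK mul_row_col mulmx0 addr0 mulmxA.
have TE : (E0 *m lsubmx L) *m T = 1%:M by rewrite -mulmxA -ST.
have [_ uT] := mulmx1_unit TE.
have WL : col_mx (usubmx (invmx L)) (dsubmx (invmx L)) *m row_mx (lsubmx L) (rsubmx L) = 1%:M.
  by rewrite vsubmxK hsubmxK mulVmx.
have LW : row_mx (lsubmx L) (rsubmx L) *m col_mx (usubmx (invmx L)) (dsubmx (invmx L)) = 1%:M.
  by rewrite vsubmxK hsubmxK mulmxV.
move: WL; rewrite mul_col_row -[1%:M in RHS]submxK => /eq_block_mx[_ _ e21 e22].
exists (invmx T *m usubmx (invmx L)), (rsubmx L), (dsubmx (invmx L)); split.
- rewrite ST mulmxA e21; apply/matrixP => i j; rewrite !mxE big1 // => l _.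
  by rewrite !mxE -val_eqE /= gtn_eqF ?mul0r //; exact: leq_trans (ltn_ord l) (leq_addr _ _).
- by rewrite e22; apply/matrixP => i j; rewrite !mxE -!val_eqE /= eqn_add2l.
- by rewrite -LW mul_row_col {1}ST -mulmxA (mulKVmx uT).
Qed.

Lemma alternating_sum m : \sum_(b < m) (-1) ^+ b = (odd m)%:R :> int.
Proof.
elim: m => [|m IH]; first by rewrite big_ord0.
by rewrite big_ord_recr /= IH -signr_odd; case: (odd m).
Qed.

(** The affine relations that connect the points [0, e_1, ..., e_r] modulo [p].
    For even [r] the alternating signs have sum [1]. For odd [r] they have sum
    [0], and the first two are replaced by [-1] and [2] if [p] is odd. For
    [p = 2] the first relation leaves out [e_r], and the second one,
    [e_r - e_1 + e_2], connects [e_r] with the others. *)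
Lemma block_relations (p r : nat) : prime p -> (0 < r)%N -> (p, r) <> (2%N, 1%N) ->
  exists nw (wt : 'I_nw -> 'I_r.+1 -> int),
  [/\ nw = if (3 <= p)%N || ((p == 2%N) && ~~ odd r) then 1%N else 2%N,
      injective wt,
      forall t, \sum_b wt t b = 1,
      forall t, exists b, wt t b = -1 &
      forall (T : Type) (z : 'I_r.+1 -> T) (y : 'I_nw -> T),
        (forall t b, ~~ (p%:Z %| wt t b)%Z -> y t = z b) ->
        (forall b, z b = z ord0) /\ (forall t, y t = z ord0)].
Proof.
move=> pr r0 npr; have p1 := prime_gt1 pr.
have pN m : ~~ (p%:Z %| ((-1) ^+ m)%R)%Z.
  by rewrite dvdzE abszX /= exp1n dvdn1; apply: contraTneq p1 => ->.
have single (w : 'I_r.+1 -> int) : \sum_b w b = 1 -> (exists b, w b = -1) ->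
    (forall b, ~~ (p%:Z %| w b)%Z) -> exists wt : 'I_1 -> 'I_r.+1 -> int,
    [/\ injective wt, forall t, \sum_b wt t b = 1, forall t, exists b, wt t b = -1 &
      forall (T : Type) (z : 'I_r.+1 -> T) (y : 'I_1 -> T),
        (forall t b, ~~ (p%:Z %| wt t b)%Z -> y t = z b) ->
        (forall b, z b = z ord0) /\ (forall t, y t = z ord0)].
  move=> w1 wN wp; exists (fun=> w); split=> // [i j _|T z y h]; first by rewrite !ord1.
  by split=> [b|t]; rewrite -?(h ord0 b) // (h _ ord0).
have [ev|od] := boolP (odd r); last first.
  rewrite andbT; have -> : (3 <= p)%N || (p == 2%N) by lia.
  have [||b|wt [? ? ? ?]] := single (fun b => (-1) ^+ b) => //.
  - by rewrite alternating_sum /= od.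
  - by exists (inord 1); rewrite inordK.
  - by exists 1%N, wt.
rewrite andbF orbF; have [p3|p2] := leqP 3 p.
  pose w (b : 'I_r.+1) : int :=
    if val b == 0%N then -1 else if val b == 1%N then 2 else (-1) ^+ b.
  have [||b|wt [? ? ? ?]] := single w.
  - have : \sum_(b < r.+1) (w b - (-1) ^+ b) = 1.
      rewrite (bigD1 ord0) //= (bigD1 (inord 1)) //=; last by rewrite -val_eqE /= inordK.
      rewrite /w /= inordK //= big1 // => b /andP[b0 b1].
      rewrite -val_eqE /= in b0; rewrite -val_eqE /= inordK // in b1.
      by rewrite (negPf b0) (negPf b1) subrr.
    by rewrite sumrB alternating_sum /= ev subr0.
  - by exists ord0.
  - rewrite /w; case: ifP => _; first exact: (pN 1%N).
    case: ifP => _; last exact: pN.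
    by rewrite dvdzE /=; apply/negP => /dvdn_leq; lia.
  - by exists 1%N, wt.
have r3 : (3 <= r)%N.
  have r1 : r <> 1%N by move=> r1; apply: npr; rewrite r1; congr pair; lia.
  by move: r0 ev r1; clear; case: r => [|[|[|?]]].
pose w1 (b : 'I_r.+1) : int := if val b == r then 0 else (-1) ^+ b.
pose w2 (b : 'I_r.+1) : int :=
  if val b == r then 1 else if val b == 1%N then -1 else if val b == 2%N then 1 else 0.
pose wt (t : 'I_2) := if val t == 0%N then w1 else w2.
have w12 : w1 ord_max <> w2 ord_max by rewrite /w1 /w2 /= eqxx.
exists 2%N, wt; split=> //.
- move=> i j; rewrite /wt => h; apply/val_inj.
  case: i j h => [[|[|//]] hi] [[|[|//]] hj] //= h; case: w12; by rewrite h.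
- move=> t; rewrite /wt; case: ifP => _.
    rewrite big_ord_recr /= /w1 /= eqxx addr0.
    transitivity (\sum_(b < r) (-1) ^+ b : int); last by rewrite alternating_sum ev.
    by apply: eq_bigr => b _; rewrite /= ltn_eqF.
  have o1 : (1 < r.+1)%N by lia. have o2 : (2 < r.+1)%N by lia.
  rewrite (bigD1 ord_max) //= (bigD1 (Ordinal o1)) /=; last by rewrite -val_eqE /=; lia.
  rewrite (bigD1 (Ordinal o2)) /=; last by rewrite -!val_eqE /=; lia.
  rewrite /w2 /= eqxx big1 => [|b]; last first.
    rewrite -!val_eqE /= => /andP[/andP[/negPf-> /negPf->] /negPf->].
    by [].
  by rewrite !ltn_eqF //; lia.
- have o1 : (1 < r.+1)%N by lia.
  have r2 : (1 < r)%N by lia.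
  by move=> t; exists (Ordinal o1); rewrite /wt /w1 /w2 /=; case: ifP => _; rewrite (ltn_eqF r2).
move=> T z y h.
have h0 b : val b != r -> y ord0 = z b.
  by move=> br; apply: h; rewrite /wt /w1 /= (negPf br).
have o1 : (1 < r.+1)%N by lia.
have hm : y ord_max = z ord_max by apply: h; rewrite /wt /w2 /= eqxx; exact: (pN 0%N).
have h1 : y ord_max = z (Ordinal o1).
  by apply: h; rewrite /wt /w2 /= (_ : 1%N == r = false); [exact: (pN 1%N)|lia].
have z0 : y ord0 = z ord0 by apply: h0 => /=; lia.
have z1 : y ord0 = z (Ordinal o1) by apply: h0 => /=; lia.
split=> [b|t].
  have [br|br] := eqVneq (val b) r; last by rewrite -h0.
  by rewrite (_ : b = ord_max) -?hm ?h1 -?z1 //; apply/val_inj.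
case: t => [[|[|//]] ht].
  by rewrite -z0; congr y; apply/val_inj.
by rewrite -z0 z1 -h1; congr y; apply/val_inj.
Qed.

(** * Integer monomials *)

Section IntegerMonomials.
Variables (k : fieldType) (d : nat).
Implicit Types (rho : 'I_d -> k) (h : 'rV[int]_d).

Definition mpow rho h : k := \prod_i rho i ^ h 0 i.

Lemma mpowD rho h1 h2 : (forall i, rho i != 0) ->
  mpow rho (h1 + h2) = mpow rho h1 * mpow rho h2.
Proof.
by move=> r0; rewrite -big_split; apply: eq_bigr => i _; rewrite mxE expfzDr.
Qed.

Lemma mpow0 rho : mpow rho 0 = 1.
Proof. by apply: big1 => i _; rewrite mxE expr0z. Qed.

Lemma mpowZ rho a h : mpow rho (a *: h) = mpow rho h ^ a.
Proof.
rewrite /mpow [RHS](big_morph (fun u : k => u ^ a) (fun u v => @expfzMl k u v a)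
  (exp1rz k a)).
by apply: eq_bigr => i _; rewrite mxE mulrC exprz_exp.
Qed.

Lemma mpow_sum rho (I : Type) (s : seq I) (f : I -> 'rV[int]_d) : (forall i, rho i != 0) ->
  mpow rho (\sum_(i <- s) f i) = \prod_(i <- s) mpow rho (f i).
Proof.
by move=> r0; exact: (big_morph (mpow rho) (fun u v => mpowD u v r0) (mpow0 rho)).
Qed.

Lemma mpow_mulmx rho m (a : 'rV[int]_m) (B : 'M[int]_(m, d)) : (forall i, rho i != 0) ->
  mpow rho (a *m B) = \prod_i mpow rho (row i B) ^ a 0 i.
Proof.
move=> r0; rewrite mulmx_sum_row mpow_sum //.
by apply: eq_bigr => i _; rewrite mpowZ.
Qed.

Lemma mpow_delta rho i : mpow rho (delta_mx 0 i) = rho i.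
Proof.
rewrite /mpow (bigD1 i) //= mxE !eqxx expr1z big1 ?mulr1 // => j ji.
by rewrite mxE (negPf ji) andbF expr0z.
Qed.

Lemma mpow_neq0 rho h : (forall i, rho i != 0) -> mpow rho h != 0.
Proof.
by move=> r0; rewrite prodf_seq_neq0; apply/allP => i _; rewrite expfz_neq0.
Qed.

End IntegerMonomials.

Lemma pchar_root_unity (k : fieldType) (p : nat) (a : k) : p \in [pchar k] ->
  a ^+ p = 1 -> a = 1.
Proof.
move=> hp e; apply/eqP; rewrite -subr_eq0.
have : (a - 1) ^+ p = 0.
  by rewrite -(pFrobenius_autE hp) rmorphB rmorph1 /= pFrobenius_autE e subrr.
by move/eqP; rewrite expf_eq0 => /andP[].
Qed.

(** * The configuration *)

(** The points are the [r + 1 + d] basis points, [nw] relation points with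
    coordinates [wt] at the first [r + 1] basis points, and [e] kernel points,
    which are multiples of the rows of [G] in [Z^d]. *)
Section Construction.
Variables (r d nw e q' c p : nat).
Variable (wt : 'I_nw -> 'I_r.+1 -> int).
Variable (G : 'M[int]_(q'.+1, d)).

(** The multiples are [p] for all rows of [G] but the last one, and [p c], [2 p c],
    ... for the last one: the first [q' + 1] kernel points generate the lattice
    that determines the fibers, and the others, which lie in this lattice, serve
    to reach the prescribed number of points. *)
Definition kernel_mult (s : nat) : int :=
  if (s < q')%N then p%:Z else (p * c)%N%:Z * (s - q').+1%:Z.

Definition kernel_row (s : 'I_e) : 'rV[int]_d :=
  kernel_mult s *: row (inord (minn s q')) G.

Definition rel_coord (t : 'I_nw) (b : 'I_(r.+1 + d)) : int :=
  match fintype.split b with inl b0 => wt t b0 | inr _ => 0 end.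

Definition kernel_coord (s : 'I_e) (b : 'I_(r.+1 + d)) : int :=
  match fintype.split b with
  | inl b0 => if b0 == ord0 then 1 - \sum_i kernel_row s 0 i else 0
  | inr i => kernel_row s 0 i
  end.

Definition coords (j : 'I_(r.+1 + d + (nw + e))) (b : 'I_(r.+1 + d)) : int :=
  match fintype.split j with
  | inl b' => (b' == b)%:R
  | inr x => match fintype.split x with
             | inl t => rel_coord t b
             | inr s => kernel_coord s b
             end
  end.

Definition basis_ix b : 'I_(r.+1 + d + (nw + e)) := lshift (nw + e) b.
Definition rel_ix t : 'I_(r.+1 + d + (nw + e)) := rshift (r.+1 + d) (lshift e t).
Definition kernel_ix s : 'I_(r.+1 + d + (nw + e)) := rshift (r.+1 + d) (rshift nw s).

Let splitl m n (i : 'I_m) : fintype.split (lshift n i) = inl i.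
Proof. exact: (unsplitK (inl i)). Qed.
Let splitr m n (i : 'I_n) : fintype.split (rshift m i) = inr i.
Proof. exact: (unsplitK (inr i)). Qed.

Lemma coords_basis b' b : coords (basis_ix b') b = (b' == b)%:R.
Proof. by rewrite /coords splitl. Qed.

Lemma coords_rel_l t b : coords (rel_ix t) (lshift d b) = wt t b.
Proof. by rewrite /coords splitr splitl /rel_coord splitl. Qed.

Lemma coords_rel_r t i : coords (rel_ix t) (rshift r.+1 i) = 0.
Proof. by rewrite /coords splitr splitl /rel_coord splitr. Qed.

Lemma coords_kernel_l s b : coords (kernel_ix s) (lshift d b) =
  if b == ord0 then 1 - \sum_i kernel_row s 0 i else 0.
Proof. by rewrite /coords !splitr /kernel_coord splitl. Qed.

Lemma coords_kernel_r s i : coords (kernel_ix s) (rshift r.+1 i) = kernel_row s 0 i.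
Proof. by rewrite /coords !splitr /kernel_coord splitr. Qed.

Variant index_spec : 'I_(r.+1 + d + (nw + e)) -> Prop :=
  | BasisIx b : index_spec (basis_ix b)
  | RelIx t : index_spec (rel_ix t)
  | KernelIx s : index_spec (kernel_ix s).

Lemma indexP j : index_spec j.
Proof.
case: (split_ordP j) => [b|x] ->; first exact: BasisIx.
by case: (split_ordP x) => [t|s] ->; [exact: RelIx|exact: KernelIx].
Qed.

Hypothesis wt_sum : forall t, \sum_b wt t b = 1.

Lemma coords_sum j : \sum_b coords j b = 1.
Proof.
case: (indexP j) => [b|t|s].
- rewrite (bigD1 b) //= coords_basis eqxx big1 // => b' bb'.
  by rewrite coords_basis eq_sym (negPf bb').
- rewrite big_split_ord /= [X in _ + X]big1 ?addr0 => [|i _]; last exact: coords_rel_r.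
  by rewrite -[RHS](wt_sum t); apply: eq_bigr => b _; rewrite coords_rel_l.
rewrite big_split_ord /= (bigD1 ord0) //= coords_kernel_l eqxx [X in _ + X + _]big1 => [|b b0].
  by rewrite addr0 (eq_bigr _ (fun i _ => coords_kernel_r s i)) subrK.
by rewrite coords_kernel_l (negPf b0).
Qed.

Lemma in_block_basis b : in_block (r + d) r (basis_ix b) = (b <= r)%N.
Proof.
rewrite /in_block /= [(r + d < b)%N]ltnNge.
by rewrite -[(b <= r + d)%N]/(b < r.+1 + d)%N ltn_ord orbF.
Qed.

Lemma in_block_rel t : in_block (r + d) r (rel_ix t).
Proof. by rewrite /in_block /= addSn ltnS leq_addr orbT. Qed.

Lemma in_block_kernel s : in_block (r + d) r (kernel_ix s).
Proof. by rewrite /in_block /= addSn ltnS leq_addr orbT. Qed.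

Lemma kernel_mult_dvd s : (p%:Z %| kernel_mult s)%Z.
Proof. by rewrite /kernel_mult; case: ifP => _ //; rewrite PoszM -mulrA dvdz_mulr. Qed.

Lemma kernel_row_dvd s i : (p%:Z %| (kernel_row s 0%R i)%R)%Z.
Proof. by rewrite mxE dvdz_mulr // kernel_mult_dvd. Qed.

Hypothesis (pr : prime p).

Lemma coords_block_dvd (j : 'I_(r.+1 + d + (nw + e))) (b : 'I_(r.+1 + d)) :
  in_block (r + d) r j -> (r < b)%N -> (p%:Z %| coords j b)%Z.
Proof.
case: (split_ordP b) => [b0 ->|i ->] bj rb; first by rewrite /= leqNgt ltn_ord in rb.
case: (indexP j) bj => [b'|t|s] bj.
- rewrite coords_basis; case: eqP => [e1|]; last by rewrite dvdz0.
  by move: bj; rewrite in_block_basis e1 leqNgt rb.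
- by rewrite coords_rel_r dvdz0.
by rewrite coords_kernel_r kernel_row_dvd.
Qed.

Hypothesis wt_connected : forall (T : Type) (z : 'I_r.+1 -> T) (y : 'I_nw -> T),
  (forall t b, ~~ (p%:Z %| wt t b)%Z -> y t = z b) ->
  (forall b, z b = z ord0) /\ (forall t, y t = z ord0).

Lemma coords_connected (T : Type) (z : 'I_(r.+1 + d + (nw + e)) -> T) :
  (forall j b, ~~ (p%:Z %| coords j b)%Z -> z j = z (basis_ix b)) ->
  forall i j : 'I_(r.+1 + d + (nw + e)),
    in_block (r + d) r i -> in_block (r + d) r j -> z i = z j.
Proof.
move=> h; pose o := basis_ix (lshift d ord0).
have [zb zt] := wt_connected (z := fun b => z (basis_ix (lshift d b)))
  (y := fun t => z (rel_ix t)) (fun t b n => h (rel_ix t) (lshift d b)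
    (eq_ind_r (fun x => ~~ (p%:Z %| x)%Z) n (coords_rel_l t b))).
suff E j : in_block (r + d) r j -> z j = z o by move=> i j /E-> /E->.
case: (indexP j) => [b|t|s]; [rewrite in_block_basis|by rewrite -/o zt|move=> _].
  case: (split_ordP b) => [b0 -> _|i -> /=]; first exact: zb.
  by rewrite leqNgt ltnS leq_addr.
apply: h; rewrite coords_kernel_l eqxx.
apply/negP => p1.
have ps : (p%:Z %| (\sum_i kernel_row s 0 i)%R)%Z.
  by apply: rpred_sum => i _; exact: kernel_row_dvd.
have := rpredD p1 ps; rewrite subrK.
by rewrite [_ \in _]dvdzE dvdn1 gtn_eqF // prime_gt1.
Qed.

Hypothesis wt_neg : forall t, exists b, wt t b = -1.

Lemma coords_sign : (0 < nw)%N ->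
  exists j0 (b0 : 'I_(r.+1 + d)), (b0 <= r)%N /\ coords j0 b0 = -1.
Proof.
move=> nw0; pose t := Ordinal nw0; have [b tb] := wt_neg t.
exists (rel_ix t), (lshift d b); rewrite coords_rel_l; split=> //=.
by rewrite -ltnS.
Qed.

Hypotheses (c_gt0 : (0 < c)%N) (wt_inj : injective wt).
Variable Th : 'M[int]_(d, q'.+1).
Hypothesis GTh : G *m Th = 1%:M.

Lemma kernel_mult_neq0 s : kernel_mult s != 0.
Proof.
have p0 := prime_gt0 pr; rewrite /kernel_mult; case: ifP => _.
  by rewrite eqz_nat -lt0n.
by rewrite mulf_neq0 // eqz_nat -lt0n muln_gt0 p0.
Qed.

Lemma kernel_rowTh s (l : 'I_q'.+1) : (kernel_row s *m Th) 0 l =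
  kernel_mult s * (l == inord (minn s q'))%:R.
Proof. by rewrite -scalemxAl -row_mul GTh !mxE eq_sym. Qed.

Lemma kernel_row_inj : injective kernel_row.
Proof.
move=> s1 s2 e12.
have h (l : 'I_q'.+1) : kernel_mult s1 * (l == inord (minn s1 q'))%:R =
    kernel_mult s2 * (l == inord (minn s2 q'))%:R.
  by rewrite -!kernel_rowTh e12.
have imin : minn s1 q' = minn s2 q'.
  have := h (inord (minn s1 q')); rewrite eqxx mulr1.
  case: eqP => [ee _|_ /eqP]; last by rewrite mulr0 (negPf (kernel_mult_neq0 _)).
  by have := congr1 val ee; rewrite /= !inordK // ltnS geq_minr.
have := h (inord (minn s1 q')); rewrite -imin !eqxx !mulr1 /kernel_mult => hm.
apply/val_inj => /=; move: imin hm; case: ltnP => s1q; case: ltnP => s2q; try lia.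
move=> _ /(mulfI _) hm; have {}hm : (s1 - q').+1%:Z = (s2 - q').+1%:Z.
  by apply: hm; rewrite eqz_nat -lt0n muln_gt0 prime_gt0.
by case: hm; lia.
Qed.

Lemma kernel_row_neq0 s : exists i, kernel_row s 0 i != 0.
Proof.
apply: contrapT => h; have k0 : kernel_row s = 0.
  apply/rowP => i; rewrite [RHS]mxE; apply/eqP; apply: contrapT => /negP n.
  by apply: h; exists i.
have := kernel_rowTh s (inord (minn s q')); rewrite k0 mul0mx mxE eqxx mulr1.
by move=> /esym/eqP; rewrite (negPf (kernel_mult_neq0 _)).
Qed.

(** A relation point has a coordinate [-1] and vanishes in [Z^d]; a kernel point
    has a nonzero coordinate in [Z^d], and it is divisible by [p]; the
    coordinates of a basis point are [0] and [1]. *)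
Lemma coords_inj : injective coords.
Proof.
have bas_rel b t : coords (basis_ix b) <> coords (rel_ix t).
  have [b1 tb1] := wt_neg t => /(congr1 (fun f => f (lshift d b1))).
  by rewrite coords_basis coords_rel_l tb1; case: eqP.
have bas_ker b s : coords (basis_ix b) <> coords (kernel_ix s).
  have [i si] := kernel_row_neq0 s => /(congr1 (fun f => f (rshift r.+1 i))).
  rewrite coords_basis coords_kernel_r => e1; have := kernel_row_dvd s i.
  rewrite -{}e1 in si *; move: si; case: (b == _) => // _.
  by rewrite dvdzE /= dvdn1 gtn_eqF // prime_gt1.
have rel_ker t s : coords (rel_ix t) <> coords (kernel_ix s).
  have [i si] := kernel_row_neq0 s => /(congr1 (fun f => f (rshift r.+1 i))).
  by rewrite coords_rel_r coords_kernel_r => e1; rewrite -e1 in si.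
move=> i j; case: (indexP i) => [b1|t1|s1]; case: (indexP j) => [b2|t2|s2] h //.
- have := congr1 (fun f => f b1) h; rewrite !coords_basis eqxx.
  by case: eqP => [->|].
- by case: (bas_rel _ _ h).
- by case: (bas_ker _ _ h).
- by case: (bas_rel _ _ (esym h)).
- congr rel_ix; apply: wt_inj; apply/funext => b.
  by rewrite -!coords_rel_l h.
- by case: (rel_ker _ _ h).
- by case: (bas_ker _ _ (esym h)).
- by case: (rel_ker _ _ (esym h)).
congr kernel_ix; apply: kernel_row_inj; apply/rowP => b.
by rewrite -!coords_kernel_r h.
Qed.

Definition lattice_point (j : 'I_(r + d + (nw + e)).+1) : 'rV[int]_(r + d) :=
  \row_i coords j (lift (ord0 : 'I_(r + d).+1) i).

Lemma lattice_point_inj : injective lattice_point.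
Proof.
move=> i j h; apply: coords_inj; apply/funext => b.
have hl a : coords i (lift (ord0 : 'I_(r + d).+1) a) =
    coords j (lift (ord0 : 'I_(r + d).+1) a).
  by have := congr1 (fun u : 'rV_ _ => u 0 a) h; rewrite !mxE.
have [a ->|->] := unliftP (ord0 : 'I_(r + d).+1) b; first exact: hl.
have E x : coords x (ord0 : 'I_(r + d).+1) =
    1 - \sum_a coords x (lift (ord0 : 'I_(r + d).+1) a).
  rewrite -(coords_sum x) -[X in _ = X - _]/(\sum_(b < (r + d).+1) coords x b).
  by rewrite big_ord_recl addrK.
by rewrite !E; congr (_ - _); apply: eq_bigr => a _; exact: hl.
Qed.

Lemma lattice_point_Aff : Aff lattice_point = [set: 'rV[int]_(r + d)].
Proof.
apply/seteqP; split=> // v _.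
pose cf (b : 'I_(r + d).+1) : int := if unlift ord0 b is Some i then v 0 i else 1 - \sum_i v 0 i.
pose a (j : 'I_(r.+1 + d + (nw + e))) : int :=
  match fintype.split j with inl b => cf b | inr _ => 0 end.
have sumE (V : zmodType) (f : 'I_(r.+1 + d + (nw + e)) -> int -> V) :
    (forall j, f j 0 = 0) ->
    \sum_j f j (a j) = \sum_(b < (r + d).+1) f (basis_ix b) (cf b).
  move=> f0; rewrite big_split_ord /= [X in _ + X]big1 ?addr0 => [|x _].
    by apply: eq_bigr => b _; rewrite /a splitl.
  by rewrite /a splitr f0.
exists a; split.
  rewrite (sumE _ (fun _ z => z)) // big_ord_recl /cf unlift_none.
  by rewrite [X in _ + X](eq_bigr (fun i => v 0 i)) ?subrK // => i _; rewrite liftK.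
rewrite (sumE _ (fun j z => lattice_point j *~ z)) => [|j]; last by rewrite mulr0z.
apply/rowP => i; rewrite summxE big_ord_recl.
rewrite (bigD1 i) //= big1 => [|i' ii'].
  rewrite addr0 -!scaler_int !mxE !coords_basis eqxx /cf liftK.
  have -> : ((ord0 : 'I_(r + d).+1) == lift ord0 i) = false by [].
  by rewrite mulr0 add0r mulr1 intz.
rewrite -scaler_int !mxE coords_basis (inj_eq (@lift_inj _ _)) (negPf ii').
by rewrite mulr0.
Qed.

End Construction.

(** * Characters that are constant on the block *)

(** Here [S] is the matrix of [Z^d -> M'] in a basis of [M'], so that [sg i] is
    the point of [A'] below the basis point [i] of [Z^d]; [G], [Th] and [E] come
    from [split_surjection]. *)
Section FiberCharacters.
Variables (k : closedFieldType) (p : nat) (hp : p \in [pchar k]).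
Variables (r d nw e q' c : nat).
Variable (wt : 'I_nw -> 'I_r.+1 -> int).
Hypothesis wt_sum : forall t, \sum_b wt t b = 1.
Variables (M' : zmodType) (m' N' : nat) (A' : 'I_N'.+1 -> M').
Variable basis : 'I_m' -> M'.
Hypothesis basis_bij : bijective (fun a : 'rV[int]_m' => \sum_i basis i *~ a 0 i).
Variables (S : 'M[int]_(d, m')) (E : 'M[int]_(m', d)).
Variables (Th : 'M[int]_(d, q'.+1)) (G : 'M[int]_(q'.+1, d)).
Hypotheses (GS : G *m S = 0) (GTh : G *m Th = 1%:M) (SETh : S *m E + Th *m G = 1%:M).
Variable sg : 'I_d -> 'I_N'.+1.
Hypothesis sgE : forall i, A' (sg i) - A' ord0 = \sum_l basis l *~ S i l.
Hypotheses (e_gt : (q' < e)%N) (c_gt0 : (0 < c)%N).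

Local Notation ix := 'I_(r.+1 + d + (nw + e)).
Local Notation bary := (coords (e := e) c p wt G).
Local Notation O := (torus_orbit (k := k) (n := r + d) (N := r + d + (nw + e)) bary).
Local Notation bas := (@basis_ix r d nw e).
Local Notation krow := (@kernel_row d e q' c p G).
Local Notation "0_b" := (lshift d (ord0 : 'I_r.+1)).

(** The index in [Z^d] of a coloop. *)
Definition free_ix (j : ix) : option 'I_d :=
  match fintype.split j with
  | inl b => match fintype.split b with inl _ => None | inr i => Some i end
  | inr _ => None
  end.

Definition fiber_sigma (j : ix) : 'I_N'.+1 := if free_ix j is Some i then sg i else ord0.
(** The coordinate along the last row of [G]. *)
Definition fiber_theta (j : ix) : int := if free_ix j is Some i then Th i ord_max else 0.
(** The last row of [G] itself, completed to sum [0]. *)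
Definition fiber_kappa (j : ix) : int :=
  if free_ix j is Some i then G ord_max i
  else if j == bas 0_b then - \sum_i G ord_max i else 0.

Lemma free_ixE i : free_ix (bas (rshift r.+1 i)) = Some i.
Proof.
by rewrite /free_ix (unsplitK (inl _ : 'I__ + 'I__)) (unsplitK (inr _ : 'I__ + 'I__)).
Qed.

Lemma free_ix_basis b : free_ix (bas (lshift d b)) = None.
Proof.
by rewrite /free_ix (unsplitK (inl _ : 'I__ + 'I__)) (unsplitK (inl _ : 'I__ + 'I__)).
Qed.

Lemma free_ix_extra x : free_ix (rshift (r.+1 + d) x) = None.
Proof. by rewrite /free_ix (unsplitK (inr _ : 'I__ + 'I__)). Qed.

Lemma free_ix_block j : in_block (r + d) r j -> free_ix j = None.
Proof.
case: (indexP j) => [b|t|s]; rewrite ?free_ix_extra //.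
rewrite in_block_basis; case: (split_ordP b) => [b0 -> _|i -> /=].
  exact: free_ix_basis.
by rewrite leqNgt ltnS leq_addr.
Qed.

Lemma block0 : in_block (r + d) r (bas 0_b). Proof. by rewrite in_block_basis. Qed.

Lemma free_sum (V : zmodType) (f : ix -> V) :
  (forall j, free_ix j = None -> j != bas 0_b -> f j = 0) ->
  \sum_j f j = f (bas 0_b) + \sum_i f (bas (rshift r.+1 i)).
Proof.
move=> f0; rewrite big_split_ord /= [X in _ + X]big1 ?addr0 => [|x _]; last first.
  by apply: f0; [exact: free_ix_extra|].
rewrite big_split_ord /=; congr (_ + _); rewrite (bigD1 ord0) //= big1 ?addr0 // => b b0.
by apply: f0; [exact: free_ix_basis|apply: contraNneq b0 => /lshift_inj/lshift_inj->].
Qed.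

Lemma fiber_kappa_sum : \sum_j fiber_kappa j = 0.
Proof.
rewrite free_sum => [|j]; last by rewrite /fiber_kappa => -> /negPf->.
rewrite {1}/fiber_kappa free_ix_basis eqxx addrC; apply/eqP; rewrite subr_eq0.
by apply/eqP/eq_bigr => i _; rewrite /fiber_kappa free_ixE.
Qed.

Lemma fiber_kappa_theta : \sum_j fiber_kappa j * fiber_theta j = 1.
Proof.
rewrite free_sum => [|j]; last by rewrite /fiber_theta => -> _; rewrite mulr0.
rewrite {1}/fiber_theta free_ix_basis mulr0 add0r.
have := congr1 (fun u : 'M_ _ => u ord_max ord_max) GTh; rewrite !mxE eqxx => h.
rewrite -[RHS]h; apply: eq_bigr => i _.
by rewrite /fiber_kappa /fiber_theta free_ixE.
Qed.

Lemma fiber_kappa_A' : \sum_j A' (fiber_sigma j) *~ fiber_kappa j = 0.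
Proof.
rewrite free_sum => [|j]; last by rewrite /fiber_kappa => -> /negPf->; rewrite mulr0z.
rewrite {1}/fiber_kappa {1}/fiber_sigma free_ix_basis eqxx mulrNz mulrz_sumr addrC -sumrB.
transitivity (\sum_i (A' (sg i) - A' ord0) *~ G ord_max i).
  by apply: eq_bigr => i _; rewrite /fiber_kappa /fiber_sigma free_ixE mulrzBl.
under eq_bigr do rewrite sgE mulrz_suml.
rewrite exchange_big big1 // => l _ /=; under eq_bigr do rewrite -mulrzA.
rewrite -mulrz_sumr; have := congr1 (fun u : 'M_(_, _) => u ord_max l) GS.
rewrite !mxE => h; rewrite (_ : \sum_i _ = 0) ?mulr0z // -[RHS]h.
by apply: eq_bigr => i _; rewrite mulrC.
Qed.

Lemma kernel_monomial (w : ix -> k) (rho : 'I_d -> k) s :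
  w (bas 0_b) != 0 -> (forall i, rho i != 0) ->
  (forall i, w (bas (rshift r.+1 i)) = w (bas 0_b) * rho i) ->
  \prod_b w (bas b) ^ bary (@kernel_ix r d nw e s) b = w (bas 0_b) * mpow rho (krow s).
Proof.
move=> w0 r0 wE; rewrite big_split_ord /= (bigD1 ord0) //= big1 => [|b b0]; last first.
  by rewrite coords_kernel_l (negPf b0).
rewrite coords_kernel_l eqxx mulr1.
transitivity (w (bas 0_b) ^ (1 - \sum_i krow s 0 i) *
    (w (bas 0_b) ^ (\sum_i krow s 0 i) * mpow rho (krow s))).
  congr (_ * _); rewrite (big_morph _ (fun u v => expfzDr u v w0) (expr0z _)) -big_split.
  by apply: eq_bigr => i _; rewrite coords_kernel_r wE expfzMl.
by rewrite mulrA -expfzDr // subrK expr1z.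
Qed.

(** A [p]-th root of unity is trivial, so of the kernel relations only the
    prime-to-[p] factor [c] of the last one survives. *)
Lemma kernel_root_unity (rho : 'I_d -> k) :
  (forall i, rho i != 0) -> (forall s, mpow rho (krow s) = 1) ->
  (forall l : 'I_q'.+1, (l < q')%N -> mpow rho (row l G) = 1) /\
  mpow rho (row ord_max G) ^+ c = 1.
Proof.
move=> r0 h; split=> [l lq|].
  have le : (l < e)%N by apply: ltn_trans e_gt.
  have := h (Ordinal le); rewrite /kernel_row /kernel_mult /= lq mpowZ.
  rewrite (_ : inord _ = l); last by apply/val_inj; rewrite /= inordK; lia.
  exact: (pchar_root_unity hp).
have := h (Ordinal e_gt); rewrite /kernel_row /kernel_mult /= ltnn subnn mulr1 mpowZ.
rewrite (_ : inord _ = ord_max); last by apply/val_inj; rewrite /= inordK; lia.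
by rewrite -exprnP mulnC exprM; exact: (pchar_root_unity hp).
Qed.

(** Conversely, [rho] is built from a character of [M'], which kills the kernel
    of [S], and from the dual coordinate [Th] to the last row of [G], along
    which the kernel points are multiples of [c]. *)
Lemma kernel_row_character (rho : 'I_d -> k) (z : k) (tau : 'I_m' -> k) s :
  z ^+ c = 1 -> z != 0 -> (forall l, tau l != 0) ->
  (forall i, rho i = z ^ Th i ord_max * \prod_l tau l ^ S i l) ->
  mpow rho (krow s) = 1.
Proof.
move=> zc z0 t0 rE.
have mono h : mpow rho h = z ^ (h *m Th) 0 ord_max * mpow tau (h *m S).
  rewrite [(_ *m Th) _ _]mxE (big_morph _ (fun u v => expfzDr u v z0) (expr0z _)).
  rewrite mpow_mulmx // -big_split; apply: eq_bigr => i _ /=.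
  rewrite rE expfzMl exprz_exp [h 0 i * _]mulrC; congr (_ * (_ ^ _)).
  by apply: eq_bigr => l _; rewrite mxE.
rewrite mono (kernel_rowTh _ _ GTh) /kernel_row -scalemxAl -row_mul GS.
rewrite (_ : row _ 0 = 0) ?scaler0 ?mpow0 ?mulr1; last first.
  by apply/rowP => i; rewrite !mxE.
rewrite /kernel_mult; case: ltnP => [sq|qs].
  rewrite -val_eqE /= inordK ?gtn_eqF ?mulr0 ?expr0z //; lia.
rewrite (_ : (ord_max == _) = true); last by rewrite -val_eqE /= inordK; lia.
rewrite mulr1 -exprz_exp -[z ^ _]exprnP mulnC exprM zc expr1n exp1rz //.
Qed.

Lemma widen_basis (h : ((r + d).+1 <= (r + d + (nw + e)).+1)%N) (b : 'I_(r + d).+1) :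
  widen_ord h b = bas b :> 'I_(r + d + (nw + e)).+1.
Proof. exact/val_inj. Qed.

Lemma coords_widen (h : ((r + d).+1 <= (r + d + (nw + e)).+1)%N) (b b' : 'I_(r + d).+1) :
  bary (widen_ord h b) b' = (b == b')%:R.
Proof. by rewrite widen_basis coords_basis. Qed.

Lemma orbitE (w : 'rV[k]_(r + d + (nw + e)).+1) :
  O w <-> (forall j, w 0 j != 0) /\ forall j : ix, w 0 j = \prod_b w 0 (bas b) ^ bary j b.
Proof.
have hN : ((r + d).+1 <= (r + d + (nw + e)).+1)%N by rewrite ltnS leq_addr.
split=> [Ow|[w0 wE]]; last first.
  apply: (orbit_of_basis (hnN := hN)) => [b|j]; first exact: w0.
  by rewrite [LHS]wE; apply: eq_bigr => b _; rewrite widen_basis.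
have w0 := orbit_neq0 Ow; split=> // j.
rewrite (closure_basisE (coords_widen hN) (coords_sum _ _ _ wt_sum) (sub_orbit_closure Ow)).
  by apply: eq_bigr => b _; rewrite widen_basis.
by move=> b _; exact: w0.
Qed.

(** For [w] in the orbit, constant on the block, the ratios [rho] of its coloop
    coordinates to this constant define a character of [Z^d]; by
    [kernel_root_unity] it is determined by its values on the section [E], which
    give the character [t] of [M'], and by its value [z] on the last row of
    [G]. *)
Lemma fiber_block_constantP (w : 'rV[k]_(r + d + (nw + e)).+1) :
  O w /\ block_constant (r + d) r (w 0) <->
  exists z t l, [/\ z ^+ c = 1, torus t, l != 0 &
    forall j, w 0 j = z ^ fiber_theta j * (l * t (A' (fiber_sigma j)))].
Proof.
pose w0 := w 0 (bas 0_b); pose rho i := w 0 (bas (rshift r.+1 i)) / w0.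
split=> [[/orbitE[wn wE] wc]|[z [t [l [zc ht l0 wE]]]]].
  have r0 i : rho i != 0 by rewrite mulf_neq0 ?invr_eq0 ?wn.
  have rE i : w 0 (bas (rshift r.+1 i)) = w 0 (bas 0_b) * rho i.
    by rewrite /rho mulrC divfK // wn.
  have [h1 h2] : (forall l : 'I_q'.+1, (l < q')%N -> mpow rho (row l G) = 1) /\
      mpow rho (row ord_max G) ^+ c = 1.
    apply: kernel_root_unity => // s; apply: (mulfI (wn (bas 0_b))).
    rewrite -(kernel_monomial s (wn _) r0 rE) -wE mulr1.
    by apply: wc; [exact: in_block_kernel|exact: block0].
  pose z := mpow rho (row ord_max G); pose tau l := mpow rho (row l E).
  have tau0 l : tau l != 0 by exact: mpow_neq0.
  have [t [ht tE]] := torus_of_basis basis_bij tau0.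
  exists z, t, (w0 / t (A' ord0)); split=> //.
    by rewrite mulf_neq0 ?invr_eq0 ?(torus_neq0 _ ht) //; exact: wn.
  have key i : rho i = z ^ Th i ord_max * t (A' (sg i) - A' ord0).
    have -> : t (A' (sg i) - A' ord0) = \prod_l tau l ^ S i l.
      rewrite sgE -[RHS](_ : \prod_l tau l ^ (row i S) 0 l = _); last first.
        by apply: eq_bigr => l _; rewrite mxE.
      by rewrite -tE; congr t; apply: eq_bigr => l _; rewrite mxE.
    (* the decomposition of the [i]-th basis vector along [E] and [G] *)
    rewrite -[LHS](mpow_delta rho) -[delta_mx 0 i]mulmx1 -SETh -rowE linearD /=.
    rewrite mpowD // !row_mul !mpow_mulmx // mulrC; congr (_ * _); last first.
      by apply: eq_bigr => l _; rewrite mxE.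
    rewrite (bigD1 ord_max) //= mxE big1 ?mulr1 // => l lq.
    rewrite h1 ?exp1rz // ltn_neqAle -[(l <= q')%N]/(l < q'.+1)%N ltn_ord andbT.
    by apply: contraNneq lq => lq; apply/eqP/val_inj.
  move=> j; have tA0 := torus_neq0 (A' ord0) ht.
  have blockE : in_block (r + d) r j ->
      w 0 j = z ^ fiber_theta j * (w0 / t (A' ord0) * t (A' (fiber_sigma j))).
    move=> bj; rewrite /fiber_theta /fiber_sigma free_ix_block // expr0z mul1r divfK //.
    by apply: wc => //; exact: block0.
  case: (indexP j) blockE => [b|u|s] blockE; last by apply: blockE; exact: in_block_kernel.
    case: (split_ordP b) blockE => [b0 -> blockE|i -> _].
      by apply: blockE; rewrite in_block_basis /= -ltnS.
    rewrite rE key /fiber_theta /fiber_sigma free_ixE -/w0.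
    have [_ tD] := ht; rewrite -{2}[A' (sg i)](subrK (A' ord0)) !tD.
    by field.
  by apply: blockE; exact: in_block_rel.
have z0 : z != 0.
  by apply: contra_eq_neq zc => ->; rewrite expr0n gtn_eqF // eq_sym oner_neq0.
have wn j : w 0 j != 0 by rewrite wE !mulf_neq0 ?expfz_neq0 ?torus_neq0.
have wblock j : in_block (r + d) r j -> w 0 j = w0.
  by move=> bj; rewrite /w0 !wE /fiber_theta /fiber_sigma !free_ix_block ?block0.
split; last by move=> i j bi bj; rewrite !wblock.
have r0 i : rho i != 0 by rewrite mulf_neq0 ?invr_eq0 ?wn.
have rE i : w 0 (bas (rshift r.+1 i)) = w 0 (bas 0_b) * rho i.
  by rewrite /rho mulrC divfK // wn.
have rhoE i : rho i = z ^ Th i ord_max * \prod_l t (basis l) ^ S i l.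
  have -> : \prod_l t (basis l) ^ S i l = t (A' (sg i) - A' ord0).
    by rewrite sgE torus_sum //; apply: eq_bigr => u _; rewrite torus_mulz.
  apply: (mulfI (wn (bas 0_b))); rewrite -rE !wE /fiber_theta /fiber_sigma free_ixE.
  rewrite free_ix_block ?block0 // expr0z mul1r.
  by have [_ tD] := ht; rewrite -{1}[A' (sg i)](subrK (A' ord0)) tD; ring.
apply/orbitE; split=> // j; case: (indexP j) => [b|u|s].
- rewrite (bigD1 b) //= coords_basis eqxx expr1z big1 ?mulr1 // => b' bb'.
  by rewrite coords_basis eq_sym (negPf bb') expr0z.
- rewrite big_split_ord /= [X in _ * X]big1 ?mulr1 => [|i _]; last first.
    by rewrite coords_rel_r expr0z.
  transitivity (w0 ^ \sum_b wt u b).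
    by rewrite wt_sum expr1z wblock // in_block_rel.
  rewrite (big_morph _ (fun x y => expfzDr x y (wn _)) (expr0z _)).
  apply: eq_bigr => b _; rewrite coords_rel_l (wblock (bas (lshift d b))) //.
  by rewrite in_block_basis /= -ltnS.
rewrite (kernel_monomial s (wn _) r0 rE) (kernel_row_character s zc z0 _ rhoE).
  by rewrite mulr1 -/w0 wblock // in_block_kernel.
by move=> u; rewrite torus_neq0.
Qed.

End FiberCharacters.

(** * The theorem *)

(** In the coordinates [tau] of the orbit, a character [t] scaled by [l] is
    [tau_0 = l] and [tau_(i+1) = l * t(e_i)]. *)
Lemma character_set_lattice (k : closedFieldType) (n N : nat)
    (bary : 'I_N.+1 -> 'I_n.+1 -> int) (bary_sum : forall j, \sum_b bary j b = 1) :
  @character_set k _ _ (fun j => \row_i bary j (lift ord0 i) : 'rV[int]_n) =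
  torus_orbit (k := k) bary.
Proof.
pose dl (i : 'I_n) : 'rV[int]_n := delta_mx 0 i.
have dlE (v : 'rV[int]_n) : \sum_i dl i *~ v 0 i = v.
  rewrite [RHS]row_sum_delta; apply: eq_bigr => i _.
  by rewrite -scaler_int intz.
have dl_bij : bijective (fun a : 'rV[int]_n => \sum_i dl i *~ a 0 i).
  by exists id => v; exact: dlE.
have ptE l (tau : 'I_n -> k) j : l != 0 ->
    torus_pt bary (fun b => l * (if unlift ord0 b is Some i then tau i else 1)) 0 j =
    l * \prod_i tau i ^ bary j (lift ord0 i).
  move=> l0; rewrite torus_pt_scale //; congr (_ * _).
  rewrite torus_ptE big_ord_recl unlift_none exp1rz mul1r.
  by apply: eq_bigr => i _; rewrite liftK.
apply/seteqP; split=> [x [t [l [ht l0 ->]]]|x [tau [tau0 ->]]].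
  exists (fun b => l * (if unlift ord0 b is Some i then t (dl i) else 1)); split.
    move=> b; rewrite mulf_neq0 //; case: unliftP => [i|] _; rewrite ?oner_neq0 //.
    exact: torus_neq0.
  apply/rowP => j; rewrite [RHS]ptE // !mxE; congr (_ * _).
  rewrite -{1}[\row_i _]dlE torus_sum //; apply: eq_bigr => i _.
  by rewrite torus_mulz // mxE.
pose rho i := tau (lift ord0 i) / tau ord0.
have r0 i : rho i != 0 by rewrite mulf_neq0 ?invr_eq0.
have [t [ht tE]] := torus_of_basis dl_bij r0.
have tauE : tau = fun b => tau ord0 * (if unlift ord0 b is Some i then rho i else 1).
  apply/funext => b; case: unliftP => [i ->|->]; last by rewrite mulr1.
  by rewrite mulrC divfK.
exists t, (tau ord0); split=> //; apply/rowP => j.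
rewrite -/(torus_pt bary tau) [in LHS]tauE ptE // !mxE; congr (_ * _).
by rewrite -[\row_i _]dlE tE; apply: eq_bigr => i _; rewrite mxE.
Qed.

(** The differences to [A' ord0] generate [M'] because [A'] generates it affinely.
    The first [N'] basis vectors are sent to them and the others to [0]. *)
Lemma affine_surjection (M' : zmodType) (m' N' d : nat) (A' : 'I_N'.+1 -> M')
    (basis : 'I_m' -> M') :
  bijective (fun a : 'rV[int]_m' => \sum_i basis i *~ a 0 i) ->
  Aff A' = [set: M'] -> (N' <= d)%N ->
  exists (sg : 'I_d -> 'I_N'.+1) (S : 'M[int]_(d, m')) (E0 : 'M[int]_(m', d)),
    [/\ forall u, u = ord0 \/ exists i, sg i = u,
        forall i, A' (sg i) - A' ord0 = \sum_l basis l *~ S i l &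
        E0 *m S = 1%:M].
Proof.
move=> bij hAff Nd; have [crd crdK Kcrd] := bij.
pose sg (i : 'I_d) : 'I_N'.+1 := if (i < N')%N then inord i.+1 else ord0.
pose S := \matrix_(i < d, l < m') crd (A' (sg i) - A' ord0) 0 l.
have SE i : A' (sg i) - A' ord0 = \sum_l basis l *~ S i l.
  by rewrite -[LHS]Kcrd; apply: eq_bigr => l _; rewrite mxE.
have aff l : exists a : 'I_N'.+1 -> int,
    basis l = \sum_u (A' u - A' ord0) *~ a u.
  have : Aff A' (basis l + A' ord0) by rewrite hAff.
  move=> [a [a1 aE]]; exists a; apply: (addIr (A' ord0)); rewrite aE.
  under [X in _ = X + _]eq_bigr do rewrite mulrzBl.
  by rewrite sumrB -mulrz_sumr a1 mulr1z subrK.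
have [a aE] := choice aff.
pose E0 := \matrix_(l < m', i < d) (if (i < N')%N then a l (sg i) else 0).
exists sg, S, E0; split=> //.
  move=> u; have [v ->|->] := unliftP ord0 u; [right|by left].
  have vd : (v < d)%N by apply: leq_trans Nd.
  exists (Ordinal vd); rewrite /sg /= ltn_ord; apply/val_inj.
  by rewrite /= inordK // ltnS.
apply/matrixP => l l'.
have basisE : basis l = \sum_i basis i *~ (delta_mx 0 l : 'rV[int]_m') 0 i.
  rewrite (bigD1 l) //= mxE !eqxx mulr1z big1 ?addr0 // => i il.
  by rewrite mxE (negPf il) andbF mulr0z.
have EE : basis l = \sum_i basis i *~ (\row_l' (E0 *m S) l l') 0 i.
  rewrite aE big_ord_recl subrr mul0rz add0r.
  pose f u := (A' u - A' ord0) *~ a l u.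
  transitivity (\sum_(i < N') f (inord i.+1)).
    apply: eq_bigr => i _; rewrite /f; have -> // : lift ord0 i = inord i.+1.
    by apply/val_inj; rewrite /= inordK // ltnS.
  rewrite (big_ord_widen d (fun i => f (inord i.+1)) Nd) big_mkcond /=.
  transitivity (\sum_(i < d) (\sum_l' basis l' *~ S i l') *~ E0 l i).
    by apply: eq_bigr => i _; rewrite -SE /f mxE /sg; case: ifP.
  transitivity (\sum_(i < d) \sum_u basis u *~ S i u *~ E0 l i).
    by apply: eq_bigr => i _; rewrite mulrz_suml.
  rewrite exchange_big /=; apply: eq_bigr => u _; rewrite [in RHS]mxE [in RHS]mxE.
  under eq_bigr do rewrite -mulrzA.
  by rewrite -mulrz_sumr; congr (_ *~ _); apply: eq_bigr => i _; rewrite mulrC.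
have := congr1 crd (etrans (esym basisE) EE); rewrite !crdK => /rowP/(_ l').
by rewrite !mxE /= eq_sym.
Qed.

Theorem theorem5p4 (k : closedFieldType) (p : nat) (hp : p \in [pchar k])
    (M' : zmodType) (m' : nat) (hM' : free_of_rank M' m')
    (N' : nat) (A' : 'I_N'.+1 -> M') (hA' : injective A')
    (hAff : Aff A' = [set: M'])
    (r c : nat) (hr : (0 < r)%N) (hc : (0 < c)%N)
    (hpr : (p, r) <> (2%N, 1%N)) (hcp : coprime c p)
    (n N : nat) (hn0 : (0 < n)%N) (hN0 : (0 < N)%N)
    (hn : (maxn (N' + r) (m' + r + 1) <= n)%N)
    (hN : ((if (3 <= p) || ((p == 2) && ~~ odd r)
            then 2 * n - m' - r + 1
            else 2 * n - m' - r + 2) <= N)%N) :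
  exists A : 'I_N.+1 -> 'rV[int]_n,
    [/\ injective A,
        Aff A = [set: 'rV[int]_n] &
        let X := toric_variety k A in
        [/\ (* closures of the components of a general fiber *)
            at_general_point X (fun x => smooth_point X x /\
              forall C, irreducible_components (gauss_fiber X x) C ->
                projectively_equivalent (X `&` zariski_closure C)
                                        (toric_variety k A')),
            (* rank of the Gauss map *)
            at_general_point X (fun x => smooth_point X x /\
              gauss_rank_at X x r) &
            (* number of components of a general fiber *)
            at_general_point X (fun x => smooth_point X x /\
              (irreducible_components (gauss_fiber X x) #= `I_c)%card)]].
Proof.
have pr := pcharf_prime hp.
have [basis bij] := hM'.
have [nw [wt [nwE wt_inj wt_sum wt_neg wt_con]]] := block_relations pr hr hpr.
have [q' [e [nE NE e_gt]]] : exists q' e, [/\ n = (r + (m' + q'.+1))%N,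
    N = (r + (m' + q'.+1) + (nw + e))%N & (q' < e)%N].
  exists (n - (m' + r + 1))%N, (N - n - nw)%N.
  move: hn hN; rewrite geq_max => /andP[_ hn']; rewrite nwE {nwE}.
  by case: ifP => _ hN'; split; lia.
(* with [d = m' + q' + 1], the kernel of [Z^d -> M'] has rank [q' + 1] *)
have Nd : (N' <= m' + q'.+1)%N.
  by move: hn; rewrite geq_max nE => /andP[]; lia.
have nw0 : (0 < nw)%N by rewrite nwE; case: ifP.
rewrite {}nE {}NE {hn hN hn0 hN0 n N nwE}; set d := (m' + q'.+1)%N in Nd *.
have [sg [S [E0 [sg_surj sgE E0S]]]] := affine_surjection bij hAff Nd.
have [E [Th [G [GS GTh SETh]]]] := split_surjection E0S.
pose bary := coords (e := e) c p wt G.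
have hN : ((r + d).+1 <= (r + d + (nw + e)).+1)%N by rewrite ltnS leq_addr.
have btB := coords_widen p c wt G hN.
have btS := coords_sum (e := e) c p G wt_sum.
have blkC j (b : 'I_(r + d).+1) : in_block (r + d) r j -> (r < b)%N -> (bary j b)%:~R = 0 :> k.
  move=> bj rb; apply/eqP; rewrite -(dvdz_pcharf hp).
  exact: coords_block_dvd.
have blkZ (z : 'I_(r + d + (nw + e)).+1 -> k) :
    (forall j (b : 'I_(r + d).+1), (bary j b)%:~R != 0 :> k -> z j = z (widen_ord hN b)) ->
    forall i j, in_block (r + d) r i -> in_block (r + d) r j -> z i = z j.
  move=> h; apply: (coords_connected pr wt_con) => j b.
  rewrite (dvdz_pcharf hp) => /h ->; congr z; exact/val_inj.
have blkN : exists j0 (b0 : 'I_(r + d).+1), (b0 <= r)%N /\ bary j0 b0 = -1.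
  exact: (coords_sign e c p G wt_neg nw0).
have rd : (r <= r + d)%N := leq_addr _ _.
have XE : toric_variety k (lattice_point c p wt G) = torus_closure bary.
  by congr zariski_closure; exact: (character_set_lattice k btS).
have [z [z_inj zP]] := roots_of_unity hp hc hcp.
have surj u : exists j, fiber_sigma (nw := nw) (e := e) (r := r) sg j = u.
  have [->|[i <-]] := sg_surj u.
    by exists (basis_ix nw e (lshift d ord0)); rewrite /fiber_sigma free_ix_basis.
  by exists (basis_ix nw e (rshift r.+1 i)); rewrite /fiber_sigma free_ixE.
exists (lattice_point c p wt G); split.
- exact: (lattice_point_inj wt_sum pr wt_neg hc wt_inj GTh).
- exact: lattice_point_Aff.
move=> X; have {}XE : X = torus_closure bary by exact: XE.
rewrite {}XE {X}; split; apply: (at_general_orbit btB btS) => x Ox;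
  (split; first exact: (torus_orbit_smooth btB btS Ox)).
- move=> C; exact: (fiber_components_projective btB btS hp blkC blkZ blkN hM' hc surj
    (fiber_block_constantP hp wt_sum bij GS GTh SETh sgE e_gt hc)
    (fiber_kappa_sum r nw e G) (fiber_kappa_theta r nw e GTh)
    (fiber_kappa_A' r nw e GS sgE) Ox z_inj zP).
- exact: (torus_gauss_rank btB btS rd blkC blkZ Ox).
exact: (fiber_components_card btB btS hp blkC blkZ blkN hM' hc surj
    (fiber_block_constantP hp wt_sum bij GS GTh SETh sgE e_gt hc)
    (fiber_kappa_sum r nw e G) (fiber_kappa_theta r nw e GTh)
    (fiber_kappa_A' r nw e GS sgE) Ox z_inj zP).
Qed.
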